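(* Let $(X,d)$ be a metric space, $\mu$ a non-atomic Borel measure on $X$, $m$ a doubling Borel measure on $X$, $1\le p<\infty$, $0<\beta\le1$, and let $\Gamma^*\subset\Gamma^\mu$ be a family of paths closed under taking non-trivial subpaths such that any two points of $X$ are joined by a path in $\Gamma^*$. Assume that $X$ supports a $(1,p)$-Poincaré inequality of exponent $\beta$ and that $\Gamma^*$ has the $\mu$-arc-chord property with exponent $\beta$. Then Lipschitz-$\beta$ functions are dense in $N^{1,p}$: for every $f\in\tilde N^{1,p}$ and every $\varepsilon>0$ there is a function $u\in\tilde N^{1,p}$ satisfying $|u(x)-u(y)|\le L\,d(x,y)^\beta$ for all $x,y\in X$ (for some $L<\infty$) with $\|f-u\|_{N^{1,p}}<\varepsilon$.
   Context: A path is a continuous map $\gamma:[a,b]\to X$; a subpath is a restriction of $\gamma$ to a subinterval, trivial if that interval is a point; $\mathrm{Im}(\gamma)=\gamma([a,b])$. $\mu$ non-atomic means $\mu(\{x\})=0$ for all $x$. $\Gamma^\mu$ is the set of all non-trivial injective paths $\gamma$ such that $0<\mu(\mathrm{Im}(\tilde\gamma))<\infty$ for every non-trivial subpath $\tilde\gamma$ of $\gamma$. For Borel $g\ge0$, $\int_\gamma g:=\int_{\mathrm{Im}(\gamma)}g\,d\mu$. A Borel $\rho:X\to[0,\infty]$ is an upper gradient of $f$ (in a set $A$) if $|f(x)-f(y)|\le\int_\gamma\rho$ for every $\gamma\in\Gamma^*$ (with image in $A$) whose endpoints $x,y$ satisfy $f(x),f(y)$ finite. For $\Gamma\subset\Gamma^*$,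 $\mathrm{Mod}_p(\Gamma)=\inf\int_Xg^p\,dm$ over Borel $g\ge0$ with $\int_\gamma g\ge1$ for all $\gamma\in\Gamma$; ''$p$-almost every path'' means outside a family of $p$-modulus zero. $\rho$ is a $p$-weak upper gradient of $f$ if the upper gradient inequality holds for $p$-almost every $\gamma\in\Gamma^*$. $\tilde N^{1,p}$ is the set of $f\in L^p(m)$ having a $p$-weak upper gradient in $L^p(m)$, with $\|f\|_{N^{1,p}}=\|f\|_{L^p(m)}+\inf_\rho\|\rho\|_{L^p(m)}$ (infimum over $p$-weak upper gradients); $N^{1,p}=\tilde N^{1,p}/\!\sim$ where $f\sim g\iff\|f-g\|_{N^{1,p}}=0$. $m$ is doubling if $0<m(B(x,2r))\le C\,m(B(x,r))<\infty$ for all balls. $X$ supports a $(1,p)$-Poincaré inequality of exponent $\beta$ if there are $C>0$, $\lambda\ge1$ such that for every ball $B$ and every pair $f,\rho$ with $f\in L^1(B)$ and $\rho$ an upper gradient of $f$ in $B$: $\frac{1}{m(B)}\int_B|f-f_B|\,dm\le C\,\mathrm{diam}(B)^\beta\big(\frac{1}{m(\lambda B)}\int_{\lambda B}\rho^p\,dm\big)^{1/p}$, where $f_B=\frac1{m(B)}\int_Bf\,dm$. $\Gamma^*$ has the $\mu$-arc-chord property with exponent $\beta$ if there is $C_\mu>0$ with $\mathrm{diam}(\mathrm{Im}(\gamma))^\beta\le C_\mu\,\mu(\mathrm{Im}(\gamma))$ for every $\gamma\in\Gamma^*$. *)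

(* Defs.v *)
From HB Require Import structures.
From mathcomp Require Import all_boot all_order all_algebra.
From mathcomp Require Import all_classical all_reals all_analysis.
From mathcomp Require Import measurable_realfun.
Set Implicit Arguments. Unset Strict Implicit. Unset Printing Implicit Defensive.
Import Order.TTheory GRing.Theory Num.Theory.
Local Open Scope classical_set_scope.
Local Open Scope ring_scope.

Section NewtonianDefs.
Context {R : realType} {disp : measure_display} {X : measurableType disp}.
Variable d : X -> X -> R.

Definition is_metric : Prop :=
  [/\ forall x y, 0 <= d x y, forall x y, d x y = 0 <-> x = y,
      forall x y, d x y = d y x & forall x y z, d x z <= d x y + d y z].

Definition dball (x : X) (r : R) : set X := [set y | d x y < r].

Definition d_open (U : set X) : Prop :=
  forall x, U x -> exists2 r, 0 < r & dball x r `<=` U.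

Definition borel_wrt_d : Prop := @measurable _ X = <<s d_open >>.

Definition diam (A : set X) : \bar R :=
  ereal_sup [set (d z.1 z.2)%:E | z in A `*` A].

(** paths gamma : [a,b] -> X; the values of pf outside [pa,pb] are irrelevant *)
Record dpath := DPath { pa : R; pb : R; pf : R -> X }.

Definition pdom (g : dpath) : set R := `[pa g, pb g].

Definition path_ok (g : dpath) : Prop :=
  pa g <= pb g /\
  forall t, pdom g t -> forall e, 0 < e ->
    exists2 del, 0 < del & forall s, pdom g s -> `|s - t| < del ->
      d (pf g s) (pf g t) < e.

Definition Im (g : dpath) : set X := pf g @` pdom g.

Definition restrict (g : dpath) (s t : R) : dpath := DPath s t (pf g).

Definition is_subinterval (g : dpath) (s t : R) : Prop :=
  pa g <= s /\ s < t /\ t <= pb g.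

Definition nontrivial (g : dpath) : Prop := pa g < pb g.

Definition path_injective (g : dpath) : Prop :=
  forall s t, pdom g s -> pdom g t -> pf g s = pf g t -> s = t.

Local Open Scope ereal_scope.

Definition Gamma_mu (mu : {measure set X -> \bar R}) : set dpath :=
  [set g | [/\ path_ok g, nontrivial g, path_injective g &
     forall s t, is_subinterval g s t ->
       0 < mu (Im (restrict g s t)) < +oo]].

Definition lint (mu : {measure set X -> \bar R}) (g : dpath) (rho : X -> \bar R)
  : \bar R := \int[mu]_(x in Im g) rho x.

Definition borel_nonneg (rho : X -> \bar R) : Prop :=
  measurable_fun setT rho /\ forall x, 0 <= rho x.

Definition ug_ineq (mu : {measure set X -> \bar R}) (f rho : X -> \bar R)
  (g : dpath) : Prop :=
  f (pf g (pa g)) \is a fin_num -> f (pf g (pb g)) \is a fin_num ->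
  `| f (pf g (pa g)) - f (pf g (pb g)) | <= lint mu g rho.

Definition upper_gradient_in (mu : {measure set X -> \bar R}) (Gs : set dpath)
  (A : set X) (f rho : X -> \bar R) : Prop :=
  borel_nonneg rho /\
  forall g, Gs g -> Im g `<=` A -> ug_ineq mu f rho g.

Definition Modp (mu m : {measure set X -> \bar R}) (p : R) (G : set dpath)
  : \bar R :=
  ereal_inf [set \int[m]_x (rho x `^ p) | rho in
     [set rho | borel_nonneg rho /\ forall g, G g -> 1 <= lint mu g rho]].

Definition pweak_ug (mu m : {measure set X -> \bar R}) (Gs : set dpath) (p : R)
  (f rho : X -> \bar R) : Prop :=
  borel_nonneg rho /\
  exists G0 : set dpath, [/\ G0 `<=` Gs, Modp mu m p G0 = 0 &
     forall g, Gs g -> ~ G0 g -> ug_ineq mu f rho g].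

Definition in_Lp (m : {measure set X -> \bar R}) (p : R) (f : X -> \bar R)
  : Prop :=
  measurable_fun setT f /\ \int[m]_x (`|f x| `^ p) < +oo.

Definition Ntilde (mu m : {measure set X -> \bar R}) (Gs : set dpath) (p : R)
  (f : X -> \bar R) : Prop :=
  in_Lp m p f /\ exists rho, pweak_ug mu m Gs p f rho /\ in_Lp m p rho.

Definition N1p_norm (mu m : {measure set X -> \bar R}) (Gs : set dpath) (p : R)
  (f : X -> \bar R) : \bar R :=
  Lnorm m p%:E f +
  ereal_inf [set Lnorm m p%:E rho | rho in [set rho | pweak_ug mu m Gs p f rho]].

Definition non_atomic (mu : {measure set X -> \bar R}) : Prop :=
  forall x, mu [set x] = 0.

Definition doubling (m : {measure set X -> \bar R}) : Prop :=
  exists C : R, forall x r, (0 < r)%R ->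
    0 < m (dball x (2 * r)) /\ m (dball x (2 * r)) <= C%:E * m (dball x r) /\
    C%:E * m (dball x r) < +oo.

(** average over B: (1/m(B)) * int_B h dm  (m(B) finite and > 0 under doubling) *)
Definition avg (m : {measure set X -> \bar R}) (B : set X) (h : X -> \bar R)
  : \bar R := ((fine (m B))^-1)%:E * \int[m]_(y in B) h y.

Definition poincare (mu m : {measure set X -> \bar R}) (Gs : set dpath)
  (p beta : R) : Prop :=
  exists C lam : R, [/\ (0 < C)%R, (1 <= lam)%R &
    forall x r, (0 < r)%R -> forall f rho : X -> \bar R,
      m.-integrable (dball x r) f ->
      upper_gradient_in mu Gs (dball x r) f rho ->
      avg m (dball x r) (fun y => `| f y - avg m (dball x r) f |)
      <= C%:E * (diam (dball x r) `^ beta)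
         * (avg m (dball x (lam * r)) (fun y => rho y `^ p)) `^ (p^-1)%R].

Definition arc_chord (mu : {measure set X -> \bar R}) (Gs : set dpath)
  (beta : R) : Prop :=
  exists2 Cm : R, (0 < Cm)%R &
    forall g, Gs g -> diam (Im g) `^ beta <= Cm%:E * mu (Im g).

Definition subpath_closed (Gs : set dpath) : Prop :=
  forall g s t, Gs g -> is_subinterval g s t -> Gs (restrict g s t).

Definition joins_points (Gs : set dpath) : Prop :=
  forall x y : X, x <> y -> exists2 g, Gs g &
    (pf g (pa g) = x /\ pf g (pb g) = y) \/ (pf g (pa g) = y /\ pf g (pb g) = x).

End NewtonianDefs.

(* Main.v *)
Require Import Defs.
From HB Require Import structures.
From mathcomp Require Import all_boot all_order all_algebra.
From mathcomp Require Import all_classical all_reals all_analysis.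
From mathcomp Require Import measurable_realfun.
From mathcomp Require Import lra ring.
Import Order.TTheory GRing.Theory Num.Theory.
Import numFieldNormedType.Exports.
Set Implicit Arguments.
Unset Strict Implicit.
Unset Printing Implicit Defensive.
Local Open Scope classical_set_scope.
Local Open Scope ring_scope.

(** Adding to a p-weak upper gradient of [f] a weight in L^p with infinite
    integral along every exceptional path gives a true upper gradient [rho] in
    L^p.  Call a ball good at height [K] if the mean of [rho^p] over its
    enlargement is at most [K^p].  By the Poincare inequality [f] oscillates by at
    most a multiple of [K r^beta], in the mean, over good balls of radius [r].
    Chaining along balls of radius [2^-i] centred in finite nets, [f] is
    beta-Hoelder with constant of order [K] outside the union of the bad balls and
    a null set; the same estimate replaces the Lebesgue differentiation theorem.
    Truncating at height [K] and extending as in McShane's theorem produces [u],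
    with [|u| <= K], and a covering argument gives [K^p m {f <> u} -> 0] as
    [K] grows.

    The arc-chord property makes a constant [L' = O(K)] an upper gradient of [u].
    On a path meeting [{f = u}] only the pieces before the first and after the last
    such point contribute to the difference of [f - u] at the ends, and they
    lie in [{f <> u}] up to a point; hence [rho + L'] restricted to
    [{f <> u}] is a p-weak upper gradient of [f - u], and its norm tends to 0. *)

(** * Integrals of nonnegative functions over varying sets *)

Section NonnegIntegral.
Context (disp : measure_display) (X : measurableType disp) (R : realType).
Variable mu : {measure set X -> \bar R}.
Implicit Types (A B D : set X) (f g w : X -> \bar R).
Local Open Scope ereal_scope.

Lemma le_nnintegral D f g : measurable D ->
  measurable_fun setT f -> measurable_fun setT g -> (forall x, 0 <= f x) ->
  (forall x, D x -> f x <= g x) ->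
  \int[mu]_(x in D) f x <= \int[mu]_(x in D) g x.
Proof.
by move=> mD mf mg f0 fg; apply: ge0_le_integral => //; exact: measurable_funTS.
Qed.

Lemma nnintegral_subset A B f : measurable A -> measurable B ->
  measurable_fun setT f -> (forall x, 0 <= f x) -> A `<=` B ->
  \int[mu]_(x in A) f x <= \int[mu]_(x in B) f x.
Proof.
by move=> mA mB mf f0 AB; apply: ge0_subset_integral => //; exact: measurable_funTS.
Qed.

(** This is continuity from above for the measure with density [w]. Since the integral over the
    largest set is finite, [w] itself is an integrable dominating function there. *)
Lemma nnintegral_cvg_bigcap (F : (set X)^nat) w :
  (forall n, measurable (F n)) -> (forall n m, (n <= m)%N -> F m `<=` F n) ->
  measurable_fun setT w -> (forall x, 0 <= w x) ->
  \int[mu]_(x in F 0%N) w x < +oo ->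
  \int[mu]_(x in F n) w x @[n --> \oo] --> \int[mu]_(x in \bigcap_n F n) w x.
Proof.
move=> mF dF mw w0 fin.
have mI : measurable (\bigcap_n F n) by exact: bigcap_measurable.
have E A : A `<=` F 0%N -> \int[mu]_(x in A) w x = \int[mu]_(x in F 0%N) (w \_ A) x.
  by move=> AF; rewrite -integral_mkcondr setIidr.
have mr A : measurable A -> measurable_fun (F 0%N) (w \_ A).
  move=> mA; apply: measurable_funTS.
  by apply/(measurable_restrictT _ _).1 => //; exact: measurable_funTS.
rewrite (E (\bigcap_n F n)); last by move=> x; apply.
under eq_cvg => n do rewrite (E (F n) (dF _ _ (leq0n n))).
have [] := @dominated_convergence _ _ _ mu _ (mF 0%N) (fun n => w \_ (F n))
   (w \_ (\bigcap_n F n)) w (fun n => mr _ (mF n)) (mr _ mI) => //.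
- apply: aeW => x _; have [xI|xI] := pselect ((\bigcap_n F n) x).
    apply: cvg_near_cst; apply: nearW => n.
    by rewrite !patchE !mem_set//; exact: xI.
  have [N xN] : exists N, ~ F N x.
    by apply: contrapT => H; apply: xI => n _; apply: contrapT => K; apply: H; exists n.
  apply: cvg_near_cst; exists N => // n /= Nn.
  by rewrite !patchE !memNset// => /(dF _ _ Nn).
- apply/integrableP; split; first exact: measurable_funTS.
  by under eq_integral do rewrite gee0_abs//.
- apply: aeW => x n _; rewrite patchE; case: ifP => _; first by rewrite gee0_abs.
  by rewrite abse0.
Qed.

End NonnegIntegral.

(** * Images of paths and integrals over their end pieces *)

Section Paths.
Context (R : realType) (disp : measure_display) (X : measurableType disp).
Variable d : X -> X -> R.
Hypotheses (dM : is_metric d) (bd : borel_wrt_d d).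

Lemma is_metric_ge0 x y : 0 <= d x y. Proof. by case: dM. Qed.
Lemma is_metric_xx x : d x x = 0. Proof. by case: dM => _ /(_ x x)[_ ->]. Qed.
Lemma is_metric_sym x y : d x y = d y x. Proof. by case: dM. Qed.
Lemma is_metric_triangle y x z : d x z <= d x y + d y z. Proof. by case: dM. Qed.

Lemma d_open_measurable (U : set X) : d_open d U -> measurable U.
Proof. by move=> oU; rewrite bd; exact: sub_sigma_algebra. Qed.

Lemma measurable_dball x r : measurable (dball d x r).
Proof.
apply: d_open_measurable => y /= xy; exists (r - d x y); rewrite ?subr_gt0//.
move=> z; rewrite /dball /= => yz.
by have := is_metric_triangle y x z; lra.
Qed.

(** The image is closed: for [y] off it, the distance from the path to [y] attains a positive
    minimum on the compact parameter interval, and the ball of that radius about [y] misses the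
    image. *)
Lemma measurable_Im (g : @dpath R disp X) : path_ok d g -> measurable (Defs.Im g).
Proof.
move=> [ab cg]; rewrite -[Defs.Im g]setCK; apply: measurableC; apply: d_open_measurable.
move=> y yg.
have : {within `[pa g, pb g], continuous (fun t => d (pf g t) y)}.
  apply/subspace_continuousP => t tab; apply/cvgrPdist_lt => e e0.
  have [del del0 H] := cg t tab e e0.
  rewrite near_withinE; near=> s => sab.
  have st : d (pf g s) (pf g t) < e.
    by apply: H => //; near: s; apply: nbhs_ball_norm; exists del => //= s;
       rewrite /ball_ /= distrC.
  rewrite /from_subspace /= ltr_norml; apply/andP; split.
    have := is_metric_triangle (pf g t) (pf g s) y; lra.
  have := is_metric_triangle (pf g s) (pf g t) y; rewrite (is_metric_sym (pf g t) (pf g s)); lra.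
move=> /(EVT_min ab)[c cab cmin].
exists (d (pf g c) y).
  rewrite lt_neqAle is_metric_ge0 andbT; apply/eqP => /esym E.
  apply: yg; exists c => //; by case: dM => _ /(_ (pf g c) y)[/(_ E)].
move=> z; rewrite /dball /= => yz [t tab tz]; have := cmin t tab; rewrite tz.
by rewrite (is_metric_sym z y) leNgt yz.
Unshelve. all: by end_near. Qed.

Lemma path_ok_restrict (g : @dpath R disp X) s t : path_ok d g ->
  pa g <= s -> s <= t -> t <= pb g -> path_ok d (Defs.restrict g s t).
Proof.
move=> [ab cg] as_ st tb; split => //= r rst e e0.
have sub v : pdom (Defs.restrict g s t) v -> pdom g v.
  rewrite /pdom /= !in_itv/= => /andP[sv vt].
  by rewrite (le_trans as_ sv) (le_trans vt tb).
have [del del0 H] := cg r (sub _ rst) e e0.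
by exists del => // v /sub; exact: H.
Qed.

Variable mu : {measure set X -> \bar R}.
Hypothesis mu0 : non_atomic mu.
Local Open Scope ereal_scope.

(* The bound passes to the limit at the first and the last point outside [A],
   and the end pieces which these cut off lie in [A]. *)
Lemma lint_end_pieces (g : @dpath R disp X) (w : X -> \bar R) (A : set X)
    (kappa : \bar R) :
  path_ok d g -> path_injective g -> borel_nonneg w -> lint mu g w < +oo ->
  measurable A -> (exists2 t, pdom g t & ~ A (pf g t)) ->
  (forall z z', pdom g z -> pdom g z' -> (z <= z')%R ->
     ~ A (pf g z) -> ~ A (pf g z') ->
     kappa <= lint mu (Defs.restrict g (pa g) z) w + lint mu (Defs.restrict g z' (pb g)) w) ->
  kappa <= \int[mu]_(x in Defs.Im g `&` A) w x.
Proof.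
move=> okg injg [mw w0] fin mA [t0 t0ab At0] H.
have ab : (pa g <= pb g)%R by case: okg.
pose Z := [set t | pdom g t /\ ~ A (pf g t)].
have Z0 : Z t0 by [].
have Zlb : has_lbound Z by exists (pa g) => t []; rewrite /pdom /= in_itv/= => /andP[].
have Zub : has_ubound Z by exists (pb g) => t []; rewrite /pdom /= in_itv/= => /andP[].
have hiZ : has_inf Z by split => //; exists t0.
have hsZ : has_sup Z by split => //; exists t0.
pose s := inf Z; pose t := sup Z.
have as_ : (pa g <= s)%R.
  by apply: lb_le_inf; [exists t0|move=> r []; rewrite /pdom /= in_itv/= => /andP[]].
have tb : (t <= pb g)%R.
  by apply: ge_sup; [exists t0|move=> r []; rewrite /pdom /= in_itv/= => /andP[]].
have st0 : (s <= t0)%R by exact: ge_inf.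
have t0t : (t0 <= t)%R by exact: ub_le_sup.
(* Clamping to the domain keeps [s + ei n] and [t - ei n] admissible when they fall outside it;
   [J c e] is the image of the parameters of the domain between [c] and [e]. *)
pose J (c e : R) := Defs.Im (Defs.restrict g (Num.max (pa g) c) (Num.min (pb g) e)).
have mI c e : (pa g <= e)%R -> (c <= pb g)%R -> (c <= e)%R -> measurable (J c e).
  move=> ae cb ce; apply: measurable_Im; apply: path_ok_restrict => //.
  - by rewrite le_max lexx.
  - by rewrite ge_max !le_min ab ae cb ce.
  - by rewrite ge_min lexx.
have IP c e x : J c e x <-> exists r, [/\ pdom g r, (c <= r)%R, (r <= e)%R & pf g r = x].
  split=> [[r]|[r [+ cr re <-]]].
    rewrite /pdom /= in_itv/= le_min ge_max => /andP[/andP[ar cr]] /andP[rb re] <-.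
    by exists r; split => //; rewrite in_itv/= ar.
  rewrite /pdom /= in_itv/= => /andP[ar rb]; exists r => //.
  by rewrite /pdom /= in_itv/= le_min ge_max ar cr rb re.
have mIm : measurable (Defs.Im g) by exact: measurable_Im.
have Isub c e : J c e `<=` Defs.Im g by move=> x /IP[r [rab _ _ <-]]; exists r.
have finJ c e : measurable (J c e) -> \int[mu]_(x in J c e) w x < +oo.
  by move=> mc; apply: le_lt_trans fin; apply: nnintegral_subset.
have [ei [n0 nm inv0]] : exists ei : nat -> R, [/\ forall n, (0 < ei n)%R,
    forall n k, (n <= k)%N -> (ei k <= ei n)%R &
    forall r, (forall n, r <= ei n)%R -> (r <= 0)%R].
  exists (fun n => n.+1%:R^-1)%R; split=> [n|n k nk|r rn]; first by rewrite invr_gt0.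
    by rewrite lef_pV2 ?posrE// ler_nat.
  rewrite leNgt; apply/negP => r0.
  have [k] := ltr_add_invr r0; rewrite add0r => kr.
  by have := rn k; rewrite leNgt kr.
pose F n := J (pa g) (s + ei n)%R.
pose G n := J (t - ei n)%R (pb g).
have mF n : measurable (F n) by apply: mI => //; have := n0 n; lra.
have mG n : measurable (G n) by apply: mI => //; have := n0 n; lra.
have cF : \int[mu]_(x in F n) w x @[n --> \oo] --> \int[mu]_(x in J (pa g) s) w x.
  have -> : J (pa g) s = \bigcap_n F n.
    apply/seteqP; split => [x /IP[r [rab ar rs <-]] n _|x Fx].
      by apply/IP; exists r; split => //; have := n0 n; lra.
    have /IP[r [rab ar _ rx]] := Fx 0%N I.
    apply/IP; exists r; split => //; rewrite -subr_le0; apply: inv0 => n.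
    have /IP[r' [r'ab _ r's r'x]] := Fx n I.
    (* By injectivity the parameters found for different [n] coincide; without it an intersection of
       images could exceed the image of the intersection. *)
    have -> : r = r' by apply: injg => //; rewrite rx r'x.
    by lra.
  apply: nnintegral_cvg_bigcap => //; last exact: (finJ _ _ (mF 0%N)).
  move=> n m /nm mn x /IP[r [rab ar rs <-]]; apply/IP; exists r; split => //.
  by apply: le_trans rs _; rewrite lerD2l.
have cG : \int[mu]_(x in G n) w x @[n --> \oo] --> \int[mu]_(x in J t (pb g)) w x.
  have -> : J t (pb g) = \bigcap_n G n.
    apply/seteqP; split => [x /IP[r [rab tr rb <-]] n _|x Fx].
      by apply/IP; exists r; split => //; have := n0 n; lra.
    have /IP[r [rab _ rb rx]] := Fx 0%N I.
    apply/IP; exists r; split => //; rewrite -subr_le0; apply: inv0 => n.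
    have /IP[r' [r'ab r't _ r'x]] := Fx n I.
    have -> : r = r' by apply: injg => //; rewrite rx r'x.
    by lra.
  apply: nnintegral_cvg_bigcap => //; last exact: (finJ _ _ (mG 0%N)).
  move=> n m /nm mn x /IP[r [rab tr rb <-]]; apply/IP; exists r; split => //.
  by apply: le_trans tr; rewrite lerD2l lerN2.
have mIs : measurable (J (pa g) s) by apply: mI => //; lra.
have mIt : measurable (J t (pb g)) by apply: mI => //; lra.
have fin_nn B : measurable B -> B `<=` Defs.Im g -> \int[mu]_(x in B) w x \is a fin_num.
  move=> mB sB; rewrite ge0_fin_numE; last by apply: integral_ge0.
  by apply: le_lt_trans fin; apply: nnintegral_subset.
have K1 : kappa <= \int[mu]_(x in J (pa g) s) w x + \int[mu]_(x in J t (pb g)) w x.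
  have cFG : \int[mu]_(x in F n) w x + \int[mu]_(x in G n) w x @[n --> \oo] -->
      \int[mu]_(x in J (pa g) s) w x + \int[mu]_(x in J t (pb g)) w x.
    by apply: cvgeD => //; exact: (fin_num_adde_defl _ (fin_nn _ mIt (@Isub _ _))).
  rewrite -(cvg_lim (@ereal_hausdorff R) cFG); apply: lime_ge; first by apply/cvg_ex; eexists; exact: cFG.
  apply: nearW => n /=.
  have [z [zab Az] zs] := inf_adherent (n0 n) hiZ.
  have [z' [zab' Az'] zt] := sup_adherent (n0 n) hsZ.
  (* The nearly minimal [z] and the nearly maximal [z'] may come in the wrong order. Exchanging them
     then keeps both within the margins, so the estimate is stated for any ordered pair. *)
  have E : forall y y', Z y -> Z y' -> (y <= y')%R -> (y < s + ei n)%R ->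
      (t - ei n < y')%R -> kappa <= \int[mu]_(x in F n) w x + \int[mu]_(x in G n) w x.
    move=> y y' [yab Ay] [yab' Ay'] yy ys yt; apply: le_trans (H _ _ yab yab' yy Ay Ay') _.
    have /andP[ya yb] : (pa g <= y <= pb g)%R by move: yab; rewrite /pdom /= in_itv.
    have /andP[ya' yb'] : (pa g <= y' <= pb g)%R by move: yab'; rewrite /pdom /= in_itv.
    apply: leeD; apply: nnintegral_subset => //.
    - by apply: measurable_Im; apply: path_ok_restrict.
    - move=> _ [r rr <-]; move: rr; rewrite /pdom /= in_itv/= => /andP[ar ry].
      apply/IP; exists r; split => //; last by lra.
      by rewrite /pdom /= in_itv/= ar (le_trans ry).
    - by apply: measurable_Im; apply: path_ok_restrict.
    - move=> _ [r rr <-]; move: rr; rewrite /pdom /= in_itv/= => /andP[ar ry].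
      apply/IP; exists r; split => //; last by lra.
      by rewrite /pdom /= in_itv/= ry andbT (le_trans ya').
  have [zz|zz] := leP z z'; first exact: (E z z').
  by apply: (E z' z) => //; [exact: ltW|apply: lt_trans zz zs|apply: lt_trans zt zz].
apply: le_trans K1 _.
have m1 (x : X) : measurable [set x].
  rewrite -[[set x]]setCK; apply: measurableC; apply: d_open_measurable => y /= yx.
  exists (d x y); last first.
    by move=> z; rewrite /dball /= => yz zx; move: yz; rewrite zx is_metric_sym ltxx.
  rewrite lt_neqAle is_metric_ge0 andbT; apply/eqP => /esym E.
  by apply: yx; case: dM => _ /(_ x y)[/(_ E)].
(* The points at [s] and [t] may lie outside [A], but they are null because [mu] is non-atomic.
   Removing them puts both end pieces inside [A] and makes them disjoint, even when [s = t]. *)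
rewrite (@ge0_negligible_integral _ _ _ _ _ [set pf g s])//; last exact: measurable_funTS.
rewrite [X in _ + X](@ge0_negligible_integral _ _ _ _ _ [set pf g t])//; last exact: measurable_funTS.
rewrite -ge0_integral_setU//; last 4 first.
- by apply: measurableD.
- by apply: measurableD.
- exact: measurable_funTS.
- apply/eqP; rewrite -subset0 => x [[/IP[r [rab _ rs <-]] /= ns] [/IP[r' [rab' r't _]] nt rr]].
  have E : r' = r by apply: injg.
  apply: ns; congr (pf g _); lra.
apply: nnintegral_subset => //.
- by apply: measurableU; apply: measurableD.
- exact: measurableI.
move=> x [] [/IP[r [rab r1 r2 rx]] /= ne]; split.
- by exists r.
- apply: contrapT => Ax; apply: ne; rewrite -rx; congr (pf g _).
  apply/eqP; rewrite eq_le r2 /=; apply: ge_inf => //; split => //.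
  by rewrite rx.
- by exists r.
- apply: contrapT => Ax; apply: ne; rewrite -rx; congr (pf g _).
  apply/eqP; rewrite eq_le r1 andbT; apply: ub_le_sup => //; split => //.
  by rewrite rx.
Qed.

End Paths.

(** * Inequalities for real powers *)

Section PowerBounds.
Context (R : realType).
Local Open Scope ereal_scope.

Lemma le_poweR (r : R) (x y : \bar R) : (0 <= r)%R -> 0 <= x -> x <= y ->
  x `^ r <= y `^ r.
Proof.
move=> r0 x0 xy; apply: gt0_ler_poweR => //; rewrite in_itv/= leey andbT//.
exact: le_trans xy.
Qed.

Lemma poweRK (p : R) (x : \bar R) : (0 < p)%R -> 0 <= x -> (x `^ p^-1) `^ p = x.
Proof. by move=> p0 x0; rewrite -poweRrM mulVf ?gt_eqF// poweRe1. Qed.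

Lemma poweRVK (p : R) (x : \bar R) : (0 < p)%R -> 0 <= x -> (x `^ p) `^ p^-1 = x.
Proof. by move=> p0 x0; rewrite -poweRrM mulfV ?gt_eqF// poweRe1. Qed.

Lemma poweR_add_le (p : R) (a b : \bar R) : (0 <= p)%R -> 0 <= a -> 0 <= b ->
  (a + b) `^ p <= (2 `^ p)%R%:E * (a `^ p + b `^ p).
Proof.
move=> p0; wlog ab : a b / a <= b.
  move=> H a0 b0; have [ab|ba] := leP a b; first exact: H.
  by rewrite addeC [X in _ * X]addeC; apply: H => //; exact: ltW.
move=> a0 b0; apply: (@le_trans _ _ ((2%:E * b) `^ p)).
  by apply: le_poweR => //; rewrite ?adde_ge0// -[2%R]/(1+1)%R EFinD ge0_muleDl// mul1e leeD2r.
rewrite poweRM// poweR_EFin; apply: lee_wpmul2l; rewrite ?lee_fin ?powR_ge0//.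
by rewrite leeDr// poweR_ge0.
Qed.

Lemma powR_subadditive (b x y : R) : (0 < b <= 1)%R -> (0 <= x)%R -> (0 <= y)%R ->
  ((x + y) `^ b <= x `^ b + y `^ b)%R.
Proof.
move=> /andP[b0 b1] x0 y0.
have [s0|s0] := eqVneq (x + y)%R 0%R.
  by rewrite s0 powR0 ?gt_eqF// addr_ge0 ?powR_ge0.
have sp : (0 < x + y)%R by rewrite lt_neqAle eq_sym s0 addr_ge0.
have K (t : R) : (0 <= t)%R -> (t <= x + y)%R -> (t / (x + y) * (x + y) `^ b <= t `^ b)%R.
  move=> t0 ts; have [->|t1] := eqVneq t 0%R; first by rewrite !mul0r powR_ge0.
  have tp : (0 < t / (x + y))%R by rewrite divr_gt0// lt_neqAle eq_sym t1.
  rewrite -[X in (_ <= X `^ _)%R](divfK s0) powRM//; last 2 first.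
  - exact: ltW.
  - exact: ltW.
  apply: ler_wpM2r; first exact: powR_ge0.
  by apply: ger1_powR => //; rewrite tp /= ler_pdivrMr// mul1r.
rewrite -[leLHS]mul1r -(divff s0) 2!mulrDl; apply: lerD; apply: K => //; lra.
Qed.

End PowerBounds.

(** * Powers of sums and tails of integrals *)

Section Integrability.
Context (disp : measure_display) (X : measurableType disp) (R : realType).
Variable m : {measure set X -> \bar R}.
Local Open Scope ereal_scope.

Lemma measurable_poweR_comp (p : R) (f : X -> \bar R) : measurable_fun setT f ->
  measurable_fun setT (fun x => f x `^ p).
Proof. by move=> mf; apply: (measurableT_comp (@measurable_poweR R p)). Qed.

Lemma integral_poweRD (p : R) (D : set X) (a b : X -> \bar R) : (0 <= p)%R ->
  measurable D -> borel_nonneg a -> borel_nonneg b ->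
  \int[m]_(x in D) ((a x + b x) `^ p) <= (2 `^ p)%R%:E *
     (\int[m]_(x in D) (a x `^ p) + \int[m]_(x in D) (b x `^ p)).
Proof.
move=> p0 mD [ma a0] [mb b0].
have mpa := measurable_poweR_comp p ma; have mpb := measurable_poweR_comp p mb.
rewrite -ge0_integralD//; last 4 first.
- by move=> x _; exact: poweR_ge0.
- exact: measurable_funTS.
- by move=> x _; exact: poweR_ge0.
- exact: measurable_funTS.
rewrite -ge0_integralZl//; last 2 first.
- by apply: emeasurable_funD; exact: measurable_funTS.
- by move=> x _; rewrite adde_ge0// poweR_ge0.
apply: le_nnintegral => //.
- by apply: measurable_poweR_comp; exact: emeasurable_funD.
- by apply: measurable_funeM; apply: emeasurable_funD.
- by move=> x; exact: poweR_ge0.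
- by move=> x _; apply: poweR_add_le.
Qed.

Lemma in_LpD (p : R) (a b : X -> \bar R) : (0 <= p)%R ->
  borel_nonneg a -> borel_nonneg b -> in_Lp m p a -> in_Lp m p b ->
  in_Lp m p (fun x => a x + b x).
Proof.
move=> p0 ba bb [ma ia] [mb ib]; split; first exact: emeasurable_funD.
have E (c : X -> \bar R) : borel_nonneg c ->
    \int[m]_x (`|c x| `^ p) = \int[m]_x (c x `^ p).
  by move=> [_ c0]; apply: eq_integral => x _; rewrite gee0_abs.
rewrite E; last first.
  by split; [exact: emeasurable_funD|move=> x; rewrite adde_ge0//; [apply ba|apply bb]].
apply: (le_lt_trans (integral_poweRD p0 measurableT ba bb)).
rewrite E// in ia; rewrite E// in ib.
by rewrite lte_mul_pinfty ?lee_fin ?powR_ge0// lte_add_pinfty.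
Qed.

(** The sets where [phi] exceeds [n] decrease to the set where it is infinite, which is null by
    integrability; continuity from above makes the tails vanish. *)
Lemma integral_tail_lt (phi : X -> \bar R) (e : R) : borel_nonneg phi ->
  \int[m]_x phi x < +oo -> (0 < e)%R ->
  exists N : nat, forall K : R, (N%:R <= K)%R ->
    \int[m]_(x in [set x | K%:E < phi x]) phi x < e%:E.
Proof.
move=> [mphi phi0] fin e0.
have mL (K : \bar R) : measurable [set x | K < phi x].
  by rewrite -[X in measurable X]setTI; exact: emeasurable_fun_o_infty.
have : \int[m]_(x in [set x | n%:R%:E < phi x]) phi x @[n --> \oo] --> 0.
  have <- : \int[m]_(x in \bigcap_n [set x | n%:R%:E < phi x]) phi x = 0.
    have -> : \bigcap_n [set x | n%:R%:E < phi x] = [set x | phi x = +oo].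
      apply/seteqP; split => x /=.
        move=> H; apply/eqyP => r r0; apply: ltW.
        have [n rn] : exists n : nat, (r <= n%:R)%R.
          by exists (Num.truncn r).+1; apply/ltW/truncnS_gt.
        by apply: le_lt_trans (H n I); rewrite lee_fin.
      by move=> H n _ /=; rewrite H ltry.
    have mi : measurable [set x | phi x = +oo].
      by have := mphi measurableT _ (@emeasurable_set1 R +oo); rewrite setTI.
    apply: null_set_integral => //; first exact: measurable_funTS.
    have ip : m.-integrable setT phi.
      by apply/integrableP; split => //; under eq_integral do rewrite gee0_abs//.
    have [A [mA A0 sA]] := integrable_ae measurableT ip.
    apply/eqP; rewrite -measure_le0 -A0; apply: le_measure; rewrite ?inE// => x /= xoo.
    by apply: sA => /= /(_ I); rewrite xoo.
  apply: nnintegral_cvg_bigcap => //.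
    move=> n k nk x /=; apply: le_lt_trans; by rewrite lee_fin ler_nat.
  by apply: le_lt_trans fin; apply: nnintegral_subset.
move=> cF.
have [N HN] : exists N : nat, \int[m]_(x in [set x | N%:R%:E < phi x]) phi x < e%:E.
  apply: contrapT => /forallNP H.
  suff : e%:E <= 0 by rewrite lee_fin leNgt e0.
  rewrite -(cvg_lim (@ereal_hausdorff R) cF); apply: lime_ge.
    by apply/cvg_ex; eexists; exact: cF.
  by apply: nearW => n; rewrite leNgt; apply/negP; exact: H.
exists N => K NK; apply: le_lt_trans HN; apply: nnintegral_subset => // x /=.
by apply: le_lt_trans; rewrite lee_fin.
Qed.

End Integrability.

(** * The p-modulus and exceptional families of paths *)

Section Modulus.
Context (R : realType) (disp : measure_display) (X : measurableType disp).
Variables (mu m : {measure set X -> \bar R}) (p : R).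
Hypothesis p0 : (0 < p)%R.
Implicit Types (G Gs : set (@dpath R disp X)) (f rho : X -> \bar R).
Local Open Scope ereal_scope.

(** Every positive multiple of [rho] is admissible for [G], and small multiples have small energy.
    The empty family is a special case. *)
Lemma Modp_lint_infty G rho : borel_nonneg rho -> in_Lp m p rho ->
  (forall g, G g -> measurable (Defs.Im g)) -> (forall g, G g -> lint mu g rho = +oo) ->
  Modp mu m p G = 0.
Proof.
move=> [mr r0] [_ ir] mG Goo.
have {}ir : \int[m]_x (rho x `^ p) < +oo.
  by move: ir; under eq_integral do rewrite gee0_abs//.
have mrp := measurable_poweR_comp p mr.
apply/eqP; rewrite eq_le; apply/andP; split; last first.
  apply: le_ereal_inf_tmp => _ [w [[_ w0] _] <-].
  by apply: integral_ge0 => x _; exact: poweR_ge0.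
apply/lee_addgt0Pr => e e0; rewrite add0e.
have [A A0 AE] : exists2 A : R, (0 <= A)%R & \int[m]_x (rho x `^ p) = A%:E.
  exists (fine (\int[m]_x (rho x `^ p))); last first.
    by rewrite fineK// ge0_fin_numE// integral_ge0// => x _; exact: poweR_ge0.
  by apply: fine_ge0; apply: integral_ge0 => x _; exact: poweR_ge0.
(* With this multiple the energy is [e * A / (A + 1) <= e]; the added 1 allows [A = 0]. *)
pose c : R := ((e / (A + 1)) `^ p^-1)%R.
have c0 : (0 < c)%R by rewrite powR_gt0// divr_gt0// ltr_wpDl.
have cp : (c `^ p = e / (A + 1))%R.
  by rewrite -powRrM mulVf ?gt_eqF// powRr1// divr_ge0// ?addr_ge0//; exact: ltW.
apply: (@le_trans _ _ (\int[m]_x ((c%:E * rho x) `^ p))).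
  apply: ereal_inf_lbound => /=; exists (fun x => c%:E * rho x) => //; split.
    split; first exact: measurable_funeM.
    by move=> x; rewrite mule_ge0// lee_fin ltW.
  move=> g Gg; rewrite /lint ge0_integralZl//; last 3 first.
  - exact: mG.
  - exact: measurable_funTS.
  - by rewrite lee_fin ltW.
  by rewrite -/(lint mu g rho) Goo// gt0_muley ?leey// lte_fin.
under eq_integral do rewrite poweRM ?lee_fin ?(ltW c0)//.
rewrite ge0_integralZl//; last 2 first.
- by move=> x _; exact: poweR_ge0.
- exact: poweR_ge0.
rewrite AE poweR_EFin cp -EFinM lee_fin mulrAC ler_pdivrMr ?ltr_wpDl//.
by rewrite ler_wpM2l ?ltW// ltrDl.
Qed.

(** Admissible functions [w_ k] of rapidly decreasing energy are combined with factors [k.+1] into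
    an l^p sum. Its p-th power is integrated term by term, without Minkowski's inequality, and it
    dominates each [k.+1%:R * w_ k], so its integral along a path of [G] exceeds every integer. *)
Lemma Modp0_weight G : (forall g, G g -> measurable (Defs.Im g)) ->
  Modp mu m p G = 0 ->
  exists w : X -> \bar R, [/\ borel_nonneg w, in_Lp m p w &
    forall g, G g -> lint mu g w = +oo].
Proof.
move=> mG M0.
have : forall k : nat, exists w : X -> \bar R, [/\ borel_nonneg w,
    forall g, G g -> 1 <= lint mu g w &
    (k.+1%:R `^ p)%R%:E * \int[m]_x (w x `^ p) <= (1 / (2 ^ k.+1)%:R)%:E].
  move=> k; have k0 : (0 < k.+1%:R `^ p :> R)%R by rewrite powR_gt0.
  have : Modp mu m p G < ((1 / (2 ^ k.+1)%:R) / k.+1%:R `^ p)%:E.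
    by rewrite M0 lte_fin divr_gt0// divr_gt0// ltr0n expn_gt0.
  move=> /ereal_inf_lt[_ [w [bw Gw] <-] /ltW H]; exists w; split => //.
  by rewrite muleC -lee_pdivlMr// EFinM in H *.
move=> /choice[w_ H].
pose V k x := (k.+1%:R%:E * w_ k x) `^ p.
have V0 k x : 0 <= V k x by exact: poweR_ge0.
have w0 k x : 0 <= w_ k x by have [[]] := H k.
have mw k : measurable_fun setT (w_ k) by have [[]] := H k.
have mV k : measurable_fun setT (V k).
  by apply: measurable_poweR_comp; exact: measurable_funeM.
pose S x := \sum_(0 <= k <oo) V k x.
have S0 x : 0 <= S x by apply: nneseries_ge0 => k _ _.
have mS : measurable_fun setT S by apply: (@ge0_emeasurable_sum _ _ _ _ _ xpredT).
have mSp : measurable_fun setT (fun x => S x `^ p^-1) by exact: measurable_poweR_comp.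
exists (fun x => S x `^ p^-1); split.
- by split => // x; exact: poweR_ge0.
- split => //; under eq_integral do rewrite gee0_abs ?poweR_ge0// poweRK//.
  rewrite /S integral_nneseries//.
  apply: (@le_lt_trans _ _ 1); last by rewrite ltry.
  apply: le_trans (epsilon_trick0 xpredT (ler01)).
  apply: lee_nneseries => [k _ _|k _]; first by apply: integral_ge0.
  have [_ _ /(le_trans _)] := H k; apply.
  rewrite -ge0_integralZl//; last 2 first.
  - exact: measurable_poweR_comp.
  - by move=> x _; exact: poweR_ge0.
  by under eq_integral do rewrite /V poweRM// poweR_EFin.
- move=> g Gg; apply/eqyP => A A0.
  pose k := Num.truncn A.
  apply: (@le_trans _ _ k.+1%:R%:E); first by rewrite lee_fin ltW// truncnS_gt.
  have [_ /(_ g Gg) wg _] := H k.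
  apply: (@le_trans _ _ (k.+1%:R%:E * lint mu g (w_ k))).
    by rewrite -[leLHS]mule1; apply: lee_wpmul2l.
  rewrite /lint -ge0_integralZl//; last 2 first.
  - exact: mG.
  - exact: measurable_funTS.
  apply: le_nnintegral => //.
  - exact: mG.
  - exact: measurable_funeM.
  - by move=> x; rewrite mule_ge0.
  - move=> x _; rewrite -[leLHS](poweRVK p0) ?mule_ge0//.
    apply: le_poweR; [by rewrite invr_ge0 ltW|exact: poweR_ge0|].
    have := @nneseries_lim_ge R (V^~ x) xpredT 0%N k.+1 (fun k _ _ => V0 k x).
    apply: (le_trans _); rewrite big_nat_recr//= leeDr// sume_ge0//.
Qed.

Lemma pweak_ug_upper_gradient Gs f rho :
  (forall g, Gs g -> measurable (Defs.Im g)) ->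
  pweak_ug mu m Gs p f rho -> in_Lp m p rho ->
  exists rho', [/\ borel_nonneg rho', in_Lp m p rho' &
    forall g, Gs g -> ug_ineq mu f rho' g].
Proof.
move=> mG [br [G0 [G0s M0 H]]] Lr.
have [w [bw Lw ww]] := Modp0_weight (fun g G0g => mG _ (G0s _ G0g)) M0.
case: (br) (bw) => mr r0 [mw w0].
exists (fun x => rho x + w x); split.
- by split; [exact: emeasurable_funD|move=> x; rewrite adde_ge0].
- by apply: in_LpD => //; exact: ltW.
move=> g Gg fa fb.
rewrite /lint ge0_integralD//; last 3 first.
- exact: mG.
- exact: measurable_funTS.
- exact: measurable_funTS.
have [G0g|nG0g] := pselect (G0 g).
  by have := ww g G0g; rewrite /lint => ->; rewrite addey ?leey// gt_eqF// (lt_le_trans ltNy0)// integral_ge0.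
apply: le_trans (H g Gg nG0g fa fb) _.
by rewrite leeDl// integral_ge0.
Qed.

End Modulus.

Lemma measurable_Hoelder (R : realType) (disp : measure_display)
    (X : measurableType disp) (d : X -> X -> R) (u : X -> R) (L b : R) :
  borel_wrt_d d -> is_metric d -> 0 < b ->
  (forall x y, `|u x - u y| <= L * d x y `^ b) -> measurable_fun setT u.
Proof.
move=> bd dM b0 uL.
apply: (measurability (@RGenOInfty.G R)); first exact: RGenOInfty.measurableE.
move=> _ [_ [r ->] <-]; rewrite setTI; apply: (d_open_measurable bd) => x /=.
rewrite in_itv/= andbT => rx.
(* The sign of [L] is not prescribed; a larger positive constant can be divided by. *)
pose L1 := Num.max L 1.
have L10 : 0 < L1 by rewrite lt_max ltr01 orbT.
pose e := (u x - r) / L1.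
have e0 : 0 < e by rewrite divr_gt0// subr_gt0.
exists (e `^ b^-1); first exact: powR_gt0.
move=> y; rewrite /dball/= => xy; rewrite in_itv/= andbT.
have : d x y `^ b < e.
  rewrite -[ltRHS](@powRr1 _ e) ?ltW// -(mulVf (lt0r_neq0 b0)) powRrM.
  by apply: gt0_ltr_powR => //; rewrite nnegrE ?powR_ge0// (is_metric_ge0 dM).
have := uL x y; rewrite ler_norml => /andP[_ H1] H2.
have H3 : L * d x y `^ b <= L1 * d x y `^ b.
  by apply: ler_wpM2r; rewrite ?powR_ge0// le_max lexx.
have H4 : L1 * d x y `^ b < u x - r.
  by rewrite mulrC -ltr_pdivlMr.
lra.
Qed.

(** * Nets and a weak-type covering bound for a doubling measure *)

Section DoublingSpace.
Context (R : realType) (disp : measure_display) (X : measurableType disp).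
Variables (d : X -> X -> R) (m : {measure set X -> \bar R}).
Hypotheses (dM : is_metric d) (bd : borel_wrt_d d).
Variables (C : R) (v : X -> R -> R).
Hypotheses (C0 : 0 < C) (mv : forall (x : X) (r : R), 0 < r -> m (dball d x r) = (v x r)%:E)
  (v0 : forall (x : X) (r : R), 0 < r -> 0 < v x r)
  (vD : forall (x : X) (r : R), 0 < r -> v x (2 * r) <= C * v x r).

Lemma volume_le x y r s : 0 < r -> 0 < s -> dball d x r `<=` dball d y s ->
  v x r <= v y s.
Proof.
move=> r0 s0 sub; rewrite -lee_fin -!mv//; apply: le_measure => //;
by rewrite inE; exact: measurable_dball.
Qed.

Lemma volume_doubling_iter x r k : 0 < r -> v x (2 ^+ k * r) <= C ^+ k * v x r.
Proof.
move=> r0; elim: k => [|k IH]; first by rewrite !expr0 !mul1r.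
rewrite !exprS -!mulrA; apply: le_trans (vD _ _) _; first by rewrite mulr_gt0// exprn_gt0.
by rewrite ler_pM2l.
Qed.

(** Balls of half the separation are disjoint, so the induction on [S] removes one ball from [D] at
    a time. *)
Lemma volume_separated_sum (S : seq X) s (D : set X) : 0 < s -> measurable D ->
  pairwise (fun q q' => s <= d q q') S ->
  (forall q, q \in S -> dball d q (s / 2) `<=` D) ->
  (\sum_(q <- S) (v q (s / 2))%:E <= m D)%E.
Proof.
move=> s0; elim: S D => [|q S IH] D mD; first by rewrite big_nil.
rewrite big_cons /= => /andP[/allP qS pS] SD.
have s20 : 0 < s / 2 by rewrite divr_gt0.
have mq := measurable_dball dM bd q (s / 2).
have qD : dball d q (s / 2) `<=` D by apply: SD; rewrite inE eqxx.
have -> : m D = (m (dball d q (s / 2)) + m (D `\` dball d q (s / 2)))%E.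
  rewrite -measureU//; first by rewrite setDUK.
  - exact: measurableD.
  - by apply/seteqP; split => // x [? []].
rewrite mv//; apply: leeD2l; apply: IH => //; first exact: measurableD.
move=> q' q'S x qx; split; first by apply: (SD q') => //; rewrite inE q'S orbT.
move=> qx'; have := qS _ q'S; rewrite leNgt => /negP; apply.
have := is_metric_triangle dM x q q'; rewrite (is_metric_sym dM x q').
move: qx qx'; rewrite /dball/=; lra.
Qed.

(** The net is a separated subset of the ball with the largest number of points. That number is
    bounded: the balls of radius [s / 2] are disjoint, and by doubling each has volume at least a
    fixed [c > 0]. *)
Lemma ball_net x0 r s : 0 < r -> 0 < s -> exists S : seq X,
  (forall x, d x0 x < r -> exists2 q, q \in S & d q x < s) /\
  \sum_(q <- S) v q (s / 2) <= v x0 (r + s).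
Proof.
move=> r0 s0; have s20 : 0 < s / 2 by rewrite divr_gt0.
have rs0 : 0 < r + s by rewrite addr_gt0.
pose sep (S : seq X) := pairwise (fun q q' => s <= d q q') S /\ forall q, q \in S -> d x0 q < r.
have sepsum S : sep S -> \sum_(q <- S) v q (s / 2) <= v x0 (r + s).
  move=> [pS Sr]; rewrite -lee_fin -mv// -sumEFin.
  apply: volume_separated_sum => //; first exact: measurable_dball.
  move=> q qS x; rewrite /dball/= => qx; have := is_metric_triangle dM q x0 x.
  have := Sr q qS; lra.
(* After [k] doublings the small ball about any point of the large ball contains the large ball. *)
have [k kP] : exists k : nat, 2 * r <= 2 ^+ k * (s / 2).
  have [k kk] : exists k : nat, 2 * r / (s / 2) <= k%:R.
    by exists (Num.truncn (2 * r / (s / 2))).+1; apply/ltW/truncnS_gt.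
  exists k; rewrite -ler_pdivrMr//; apply: le_trans kk _.
  by rewrite -natrX ler_nat; exact/ltnW/ltn_expl.
pose c := v x0 r / C ^+ k.
have Ck : 0 < C ^+ k by rewrite exprn_gt0.
have c0 : 0 < c by rewrite divr_gt0// v0.
have cv q : d x0 q < r -> c <= v q (s / 2).
  move=> qr; rewrite ler_pdivrMr// mulrC; apply: le_trans (volume_doubling_iter _ _ s20).
  apply: volume_le => //; first by rewrite mulr_gt0// exprn_gt0.
  move=> x; rewrite /dball/= => x0x; apply: lt_le_trans kP.
  by have := is_metric_triangle dM x0 q x; rewrite (is_metric_sym dM q x0); lra.
have sizeS S : sep S -> (size S <= Num.truncn (v x0 (r + s) / c))%N.
  move=> sS; rewrite truncn_ge_nat; last by rewrite divr_ge0 ?ltW// v0.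
  rewrite ler_pdivlMr//; apply: le_trans (sepsum S sS).
  have -> : (size S)%:R * c = \sum_(q <- S) c.
    by rewrite mulr_natl big_const_seq count_predT iter_addr_0.
  rewrite big_seq [leRHS]big_seq; apply: ler_sum => q qS; apply: cv.
  by case: sS => _; apply.
pose P n := `[< exists2 S, sep S & size S = n >].
have exP : exists n, P n by exists 0%N; apply/asboolP; exists [::] => //; split.
have ubP n : P n -> (n <= Num.truncn (v x0 (r + s) / c))%N.
  by move=> /asboolP[S sS <-]; exact: sizeS.
have [N /asboolP[S sS SN] maxN] := ex_maxnP exP ubP.
exists S; split; last exact: sepsum.
move=> x xr; apply: contrapT => nS.
suff /maxN : P N.+1 by rewrite ltnn.
apply/asboolP; exists (x :: S); last by rewrite /= SN.
case: sS => pS Sr; split => /=; last first.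
  by move=> q; rewrite inE => /orP[/eqP->//|/Sr].
rewrite pS andbT; apply/allP => q qS; rewrite leNgt; apply/negP => xq.
by apply: nS; exists q => //; rewrite (is_metric_sym dM).
Qed.

(** The pairs are centre and radius; the radius is recorded because a ball, as a set, does not
    determine it. *)
Definition ball_union (L : seq (X * R)) : set X :=
  [set x | exists2 b, b \in L & dball d b.1 b.2 x].

Lemma measurable_ball_union L : measurable (ball_union L).
Proof.
elim: L => [|b L IH].
  by rewrite (_ : ball_union _ = set0)//; apply/seteqP; split => // x [].
rewrite (_ : ball_union _ = dball d b.1 b.2 `|` ball_union L).
  by apply: measurableU => //; exact: measurable_dball.
apply/seteqP; split => x.
  by move=> [c]; rewrite inE => /orP[/eqP->|cL cx]; [left|right; exists c].
by move=> [bx|[c cL cx]]; [exists b => //; rewrite inE eqxx|exists c => //; rewrite inE cL orbT].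
Qed.

Lemma exists_max_radius (L : seq (X * R)) : L != [::] ->
  exists2 b, b \in L & forall c, c \in L -> c.2 <= b.2.
Proof.
elim: L => // b L IH _; have [->|/IH[b' b'L H]] := eqVneq L [::].
  by exists b; rewrite ?inE// => c; rewrite inE => /eqP->.
have [bb|bb] := leP b.2 b'.2.
  by exists b'; rewrite ?inE ?b'L ?orbT// => c; rewrite inE => /orP[/eqP->//|/H].
exists b; rewrite ?inE ?eqxx// => c; rewrite inE => /orP[/eqP->//|/H] cb.
by rewrite (le_trans cb)// ltW.
Qed.

Local Open Scope ereal_scope.

(* Remove a ball of maximal radius together with all balls meeting it: the
   removed ones lie in the fourfold ball, the others are disjoint from it. *)
Lemma measure_ball_union (psi : X -> \bar R) (k : R) (L : seq (X * R)) :
  borel_nonneg psi -> (0 <= k)%R ->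
  (forall b, b \in L -> (0 < b.2)%R /\
    k%:E * m (dball d b.1 b.2) <= \int[m]_(x in dball d b.1 b.2) psi x) ->
  k%:E * m (ball_union L) <= (C ^+ 2)%:E * \int[m]_(x in ball_union L) psi x.
Proof.
move=> [mpsi psi0] k0.
have [n] := ubnP (size L); elim: n L => // n IH L sL HL.
have [->|L0] := eqVneq L [::].
  rewrite (_ : ball_union _ = set0); last by apply/seteqP; split => // x [].
  by rewrite measure0 mule0 integral_set0 mule0.
have [b bL bmax] := exists_max_radius L0.
have [b0 kb] := HL b bL.
(* The ball [b] meets itself at its centre, so it is filtered out and the list becomes shorter. *)
pose L' := [seq c <- L | `[< dball d b.1 b.2 `&` dball d c.1 c.2 = set0 >]].
have L'P c : c \in L' -> c \in L /\ dball d b.1 b.2 `&` dball d c.1 c.2 = set0.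
  by rewrite mem_filter => /andP[/asboolP].
have sL' : (size L' < n)%N.
  rewrite -ltnS; apply: leq_trans sL; rewrite ltnS size_filter.
  rewrite ltn_neqAle count_size andbT -all_count; apply/allP => /(_ b bL) /asboolP.
  move=> /seteqP[/(_ b.1) + _]; apply; rewrite /dball; split => /=; by rewrite (is_metric_xx dM).
have HL' := IH L' sL' (fun c cL => HL c (L'P c cL).1).
have mb := measurable_dball dM bd b.1 b.2.
have mL' := measurable_ball_union L'.
have b40 : (0 < 2 ^+ 2 * b.2)%R by rewrite mulr_gt0.
apply: (@le_trans _ _ (k%:E * (m (dball d b.1 (2 ^+ 2 * b.2)) + m (ball_union L')))).
  apply: lee_wpmul2l; first by rewrite lee_fin.
  apply: le_trans (measureU2 _ _ _) => //; last exact: measurable_dball.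
  apply: le_measure; rewrite ?inE; first exact: measurable_ball_union.
    by apply: measurableU => //; exact: measurable_dball.
  move=> x [c cL cx]; have [ci|ci] := pselect (dball d b.1 b.2 `&` dball d c.1 c.2 = set0).
    by right; exists c => //; rewrite mem_filter cL andbT; apply/asboolP.
  (* A ball of radius at most [b.2] that meets the ball [b] stays within [3 * b.2] of its centre;
     the next power of two is 4, hence the two doublings in [C ^+ 2]. *)
  left; move/eqP/set0P : ci => [z []]; move: cx; rewrite /dball /= => cx bz cz.
  have := bmax c cL; have := is_metric_triangle dM z b.1 x; have := is_metric_triangle dM c.1 z x.
  rewrite (is_metric_sym dM z c.1) expr2; lra.
rewrite ge0_muleDr//.
apply: (@le_trans _ _ ((C ^+ 2)%:E * \int[m]_(x in dball d b.1 b.2) psi x +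
                       (C ^+ 2)%:E * \int[m]_(x in ball_union L') psi x)).
  apply: leeD => //.
  apply: (@le_trans _ _ ((C ^+ 2)%:E * (k%:E * m (dball d b.1 b.2)))); last first.
    by apply: lee_wpmul2l => //; rewrite lee_fin exprn_ge0// ltW.
  rewrite muleCA; apply: lee_wpmul2l; first by rewrite lee_fin.
  by rewrite !mv// -EFinM lee_fin; exact: volume_doubling_iter.
rewrite -ge0_muleDr ?integral_ge0//; apply: lee_wpmul2l.
  by rewrite lee_fin exprn_ge0// ltW.
rewrite -ge0_integral_setU//.
- apply: nnintegral_subset => //; [exact: measurableU|exact: measurable_ball_union|].
  move=> x [bx|[c /L'P[cL _] cx]]; first by exists b.
  by exists c.
- exact: measurable_funTS.
- apply/eqP; rewrite -subset0 => x [bx [c /L'P[_ <-] cx]]; by split.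
Qed.

(** The covering bound is applied to [phi] restricted to [D], the set where it exceeds [k / 2], with
    threshold [k / 2]. Halving the threshold gives the factor 2 and leaves a tail of the integral on
    the right, which is what makes the bound tend to 0 later. *)
Lemma weak_type (phi : X -> \bar R) (k : R) (M : nat -> seq (X * R)) :
  borel_nonneg phi -> (0 < k)%R ->
  (forall j b, b \in M j -> (0 < b.2)%R /\
     k%:E * m (dball d b.1 b.2) < \int[m]_(x in dball d b.1 b.2) phi x) ->
  k%:E * m (\bigcup_j ball_union (M j)) <=
    (2 * C ^+ 2)%:E * \int[m]_(x in [set x | (k / 2)%:E < phi x]) phi x.
Proof.
move=> [mphi phi0] k0 HM.
pose D := [set x | (k / 2)%:E < phi x].
have k20 : (0 <= k / 2)%R by rewrite divr_ge0// ltW.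
have mD : measurable D by rewrite -[D]setTI; exact: emeasurable_fun_o_infty.
have mDphi : measurable_fun setT (phi \_ D).
  by apply/(measurable_restrictT _ _).1 => //; exact: measurable_funTS.
have Dphi0 x : 0 <= (phi \_ D) x by rewrite patchE; case: ifP.
(* These finite lists exhaust the countable family, and continuity from below passes to the
   union. *)
pose L n := flatten [seq M j | j <- iota 0 n].
have LM n b : b \in L n -> exists2 j, (j < n)%N & b \in M j.
  move=> /flattenP[s /mapP[j]]; rewrite mem_iota add0n => /andP[_ jn] -> bM.
  by exists j.
have ML n b j : (j < n)%N -> b \in M j -> b \in L n.
  move=> jn bM; apply/flattenP; exists (M j) => //; apply/mapP; exists j => //.
  by rewrite mem_iota add0n.
have ndL : {homo (fun n => ball_union (L n)) : n k / (n <= k)%N >-> (n <= k)%O}.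
  move=> n i ni; apply/subsetPset => x [b /LM[j jn bM] bx]; exists b => //.
  by apply: (@ML _ _ j) => //; exact: leq_trans ni.
have UE : \bigcup_j ball_union (M j) = \bigcup_n ball_union (L n).
  apply/seteqP; split => x [n _ [b bM bx]].
    by exists n.+1 => //; exists b => //; apply: (@ML _ _ n).
  by have [j _ bj] := LM _ _ bM; exists j => //; exists b.
have mU : measurable (\bigcup_n ball_union (L n)).
  by apply: bigcup_measurable => n _; exact: measurable_ball_union.
rewrite UE.
have cv : (fun n => (k / 2)%:E * m (ball_union (L n))) n @[n --> \oo] -->
    (k / 2)%:E * m (\bigcup_n ball_union (L n)).
  apply: cvgeZl => //.
  exact: (nondecreasing_cvg_mu (fun n => measurable_ball_union (L n)) mU ndL).
have -> : k%:E = 2%:E * (k / 2)%:E by rewrite -EFinM mulrC divfK.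
rewrite [(2 * C ^+ 2)%:E]EFinM -!muleA; apply: lee_wpmul2l; first by rewrite lee_fin.
rewrite -(cvg_lim (@ereal_hausdorff R) cv); apply: lime_le.
  by apply/cvg_ex; eexists; exact: cv.
apply: nearW => n.
apply: le_trans (@measure_ball_union (phi \_ D) _ (L n) _ k20 _) _ => //.
- move=> b /LM[j _ bM]; have [b0 kb] := HM j b bM; split => //.
  have mb := measurable_dball dM bd b.1 b.2.
  (* Outside [D] the function is at most [k / 2], so restricting it to [D] lowers the mean over the
     ball by at most [k / 2]. *)
  have : \int[m]_(x in dball d b.1 b.2) phi x <=
      \int[m]_(x in dball d b.1 b.2) (phi \_ D) x + (k / 2)%:E * m (dball d b.1 b.2).
    rewrite -integral_cst// -ge0_integralD//; last exact: measurable_funTS.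
    apply: le_nnintegral => //; first exact: emeasurable_funD.
    move=> x _; rewrite patchE /=; case: ifPn => [_|]; first by rewrite leeDl.
    by rewrite notin_setE /D/= => /negP; rewrite -leNgt add0e.
  move=> H; have {H} := lt_le_trans kb H.
  have -> : k%:E = (k / 2)%:E + (k / 2)%:E by rewrite -EFinD; congr EFin; lra.
  rewrite ge0_muleDl// lteD2rE => [/ltW//|].
  by rewrite mv// -EFinM.
- apply: lee_wpmul2l; first by rewrite lee_fin exprn_ge0// ltW.
  rewrite -integral_mkcondr; apply: nnintegral_subset => //.
  by apply: measurableI => //; exact: measurable_ball_union.
Qed.

End DoublingSpace.

(** Ball volumes are recorded as real numbers [v], so that later estimates are real arithmetic.
    Positivity of the larger ball forces [C > 0], and then finiteness of [C] times the volume forces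
    finiteness of the volume. *)
Lemma doubling_volume (R : realType) (disp : measure_display)
    (X : measurableType disp) (d : X -> X -> R) (m : {measure set X -> \bar R}) :
  doubling d m -> exists C v, [/\ (0 : R) < C,
    forall (x : X) (r : R), 0 < r -> m (dball d x r) = (v x r)%:E,
    forall (x : X) (r : R), 0 < r -> 0 < v x r &
    forall (x : X) (r : R), 0 < r -> v x (2 * r) <= C * v x r].
Proof.
move=> [C HC].
have pos x r : 0 < r -> (0 < m (dball d x r))%E.
  move=> r0; have r20 : 0 < r / 2 by rewrite divr_gt0.
  by have [] := HC x (r / 2) r20; rewrite mulrCA divff// mulr1.
have C0 : 0 < C.
  have [H [H1 _]] := HC point 1 ltr01; rewrite ltNge; apply/negP => Cle.
  have := lt_le_trans H H1; rewrite ltNge => /negP; apply.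
  by rewrite mule_le0_ge0// lee_fin.
have fin x r : 0 < r -> m (dball d x r) \is a fin_num.
  move=> r0; rewrite ge0_fin_numE//; have [_ [_]] := HC x r r0.
  by case: (m (dball d x r)) => [a _||//]; [exact: ltry|rewrite gt0_muley].
exists C, (fun x r => fine (m (dball d x r))); split => //.
- by move=> x r r0; rewrite fineK// fin.
- by move=> x r r0; rewrite fine_gt0// pos//= -ge0_fin_numE// fin.
- move=> x r r0; rewrite -lee_fin EFinM !fineK ?fin ?mulr_gt0//.
  by have [_ []] := HC x r r0.
Qed.

(** At an exceptional point all [g j] with [j] beyond some [i] are at least some [1 / (k + 1)]. By
    Markov's inequality the set of such points has measure at most [k + 1] times the integral of any
    such [g j], hence 0. *)
Lemma ae_frequently_small (disp : measure_display) (X : measurableType disp)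
    (R : realType) (m : {measure set X -> \bar R}) (g : nat -> X -> \bar R) :
  (forall j, borel_nonneg (g j)) ->
  (forall (e : R) i, 0 < e -> exists2 j, (i <= j)%N & (\int[m]_x g j x <= e%:E)%E) ->
  m.-negligible [set y | ~ forall (e : R) i, 0 < e ->
     exists2 j, (i <= j)%N & (g j y < e%:E)%E].
Proof.
move=> bg small.
pose A k i : set X := \bigcap_j [set y | (i <= j)%N -> (k.+1%:R^-1%:E <= g j y)%E].
have mA k i : measurable (A k i).
  apply: bigcap_measurable => // j _; have [ij|ij] := leqP i j; last first.
    rewrite [X in measurable X](_ : _ = setT)//.
    by apply/seteqP; split => // y _ /= ij'; move: ij; rewrite ltnNge ij'.
  rewrite [X in measurable X](_ : _ = setT `&` [set y | (k.+1%:R^-1%:E <= g j y)%E]).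
    by apply: emeasurable_fun_c_infty => //; case: (bg j).
  by rewrite setTI; apply/seteqP; split => y /=; [exact|move=> + _].
apply: (@negligibleS _ _ _ _ (\bigcup_k \bigcup_i A k i)).
  move=> y /= H; apply: contrapT => nA; apply: H => e i e0; apply: contrapT => nj.
  have [k ke] := ltr_add_invr e0; rewrite add0r in ke.
  apply: nA; exists k => //; exists i => // j _ /= ij; rewrite leNgt; apply/negP => gj.
  by apply: nj; exists j => //; apply: lt_trans gj _; rewrite lte_fin.
apply: negligible_bigcup => k; apply: negligible_bigcup => i.
apply/negligibleP => //; apply/eqP; rewrite -measure_le0.
have k0 : 0 < k.+1%:R^-1 :> R by rewrite invr_gt0.
rewrite -(@pmule_rle0 _ (k.+1%:R^-1)%:E) ?lte_fin//.
apply/lee_addgt0Pr => e e0; rewrite add0e.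
have [j ij gj] := small e i e0; apply: le_trans gj.
have [mg g0] := bg j.
have := le_integral_abse m measurableT mg k0.
under [X in (_ <= X)%E -> _]eq_integral do rewrite gee0_abs//.
apply: le_trans; apply: lee_wpmul2l; first by rewrite lee_fin ltW.
apply: le_measure; rewrite ?inE//.
  by apply: emeasurable_fun_c_infty => //; exact: measurableT_comp.
by move=> y /(_ j I)/(_ ij) H; split => //=; rewrite gee0_abs.
Qed.

(** * Hoelder continuity off the bad balls by chaining, and McShane extension *)

Section HoelderOnGoodSet.
Context (R : realType) (disp : measure_display) (X : measurableType disp).
Variables (d : X -> X -> R) (m : {measure set X -> \bar R}).
Hypotheses (dM : is_metric d) (bd : borel_wrt_d d).
Variables (C : R) (v : X -> R -> R).
Hypotheses (C0 : 0 < C)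
  (mv : forall (x : X) (r : R), 0 < r -> m (dball d x r) = (v x r)%:E)
  (v0 : forall (x : X) (r : R), 0 < r -> 0 < v x r)
  (vD : forall (x : X) (r : R), 0 < r -> v x (2 * r) <= C * v x r).

Variable b : R.
Hypothesis b01 : 0 < b <= 1.

Let r (i : nat) : R := 2^-1 ^+ i.
Let r0 i : 0 < r i. Proof. by rewrite /r exprn_gt0// invr_gt0. Qed.
Let rS i : r i.+1 = r i / 2. Proof. by rewrite /r exprSr. Qed.

Variables (x0 : X) (S : nat -> nat -> seq X) (W : nat -> R).
Hypotheses (Snet : forall n i x, d x0 x < n.+1%:R ->
    exists2 q, q \in S n i & d q x < r i / 8)
  (SW : forall n i, \sum_(q <- S n i) v q (r i) <= W n).

Variables (f : X -> \bar R) (a : X -> nat -> R) (good : X -> nat -> bool) (T : R).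
Hypotheses (mf : measurable_fun setT f) (T0 : 0 <= T)
  (Hgood : forall q i, good q i ->
    (\int[m]_(x in dball d q (r i)) `|f x - (a q i)%:E| <=
       (T * r i `^ b * v q (r i))%:E)%E).

(** One step of the chain costs [T * (1 + C ^+ 2) * r j]^ b[. The denominator turns this into a
    difference of consecutive terms]A0 * T * r j [^ b], so the chain telescopes. *)
Let A0 : R := (1 + C ^+ 2) / (1 - 2^-1 `^ b).

Let half_pow : 2^-1 `^ b < 1 :> R.
Proof.
case/andP: b01 => b0 _; apply: (@lt_le_trans _ _ (1 `^ b)); last by rewrite powR1.
apply: gt0_ltr_powR => //.
- by rewrite nnegrE invr_ge0.
- by rewrite nnegrE.
- by rewrite invf_lt1// ltr1n.
Qed.

Let A0_ge0 : 0 <= A0.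
Proof.
apply: divr_ge0; first by apply: addr_ge0 => //; rewrite exprn_ge0// ltW.
by rewrite subr_ge0 ltW.
Qed.

Let rpow_step i : r i.+1 `^ b = 2^-1 `^ b * r i `^ b.
Proof. by rewrite rS mulrC powRM// ?invr_ge0// ltW. Qed.

(** All deviations of [f] from the constants of good net balls at scale [j], added up. The bound
    [W n] on the total volume of these balls makes the integral tend to 0 as [j] grows. *)
Let osc n j x := (\sum_(q <- S n j)
  (if good q j then ((fun y => `|f y - (a q j)%:E|) \_ (dball d q (r j))) x else 0))%E.

Let osc_ge0 j q x : (0 <= (if good q j then
  ((fun y => `|f y - (a q j)%:E|) \_ (dball d q (r j))) x else 0))%E.
Proof. by case: ifP => // _; rewrite patchE; case: ifP. Qed.

Let dev_measurable q j : measurable_fun setT (fun y => `|f y - (a q j)%:E|)%E.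
Proof. by apply: measurableT_comp => //; apply: emeasurable_funB. Qed.

Let osc_measurable j q : measurable_fun setT (fun x => if good q j then
  ((fun y => `|f y - (a q j)%:E|) \_ (dball d q (r j))) x else 0)%E.
Proof.
case: (good q j) => //.
apply/(measurable_restrictT _ _).1; first exact: measurable_dball.
exact: measurable_funTS.
Qed.

Let integral_osc n j : (\int[m]_x osc n j x <= (T * W n * r j `^ b)%:E)%E.
Proof.
rewrite ge0_integral_sum//.
apply: (@le_trans _ _ (\sum_(q <- S n j) (T * r j `^ b * v q (r j))%:E)%E).
  apply: lee_sum => q _; case: (boolP (good q j)) => [/Hgood|_].
    by rewrite [X in (X <= _)%E -> _]integral_mkcond.
  rewrite integral0 lee_fin mulr_ge0//; last by apply: ltW; exact: v0.
  by rewrite mulr_ge0// powR_ge0.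
rewrite sumEFin lee_fin -mulr_sumr mulrAC.
by rewrite ler_wpM2r ?powR_ge0// ler_wpM2l.
Qed.

Let rpow_small (e : R) i : 0 < e -> exists2 j, (i <= j)%N & r j `^ b < e.
Proof.
move=> e0; have E j : r j `^ b = (2^-1 `^ b) ^+ j.
  elim: j => [|j IH]; first by rewrite /r !expr0 powR1.
  by rewrite rpow_step IH exprS.
have : (2^-1 `^ b) ^+ j @[j --> \oo] --> 0.
  by apply: cvg_expr; rewrite ger0_norm ?powR_ge0.
move=> /cvgrPdist_lt/(_ e e0)[N _ HN].
exists (maxn i N); first exact: leq_maxl.
have /= := HN (maxn i N) (leq_maxr _ _); rewrite sub0r normrN -E.
by rewrite ger0_norm ?powR_ge0.
Qed.

Definition goodset : set X :=
  [set y | forall n i q, q \in S n i -> d q y < r i -> good q i].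

Let osc_frequently_small n : m.-negligible [set y | ~ forall (e : R) i, 0 < e ->
     exists2 j, (i <= j)%N & (osc n j y < e%:E)%E].
Proof.
apply: ae_frequently_small.
  by move=> j; split=> [|x]; [apply: emeasurable_sum|apply: sume_ge0].
move=> e i e0.
(* The sign of [W n] is unknown and [T] may vanish; this majorant is positive and can be divided
   by. *)
have [M0 MW] : 0 < T * `|W n| + 1 /\ T * W n <= T * `|W n| + 1.
  split; first by rewrite ltr_wpDl// mulr_ge0.
  by rewrite (@le_trans _ _ (T * `|W n|)) ?ler_wpM2l ?ler_norm// lerDl.
have [j ij je] := rpow_small i (divr_gt0 e0 M0).
exists j => //; apply: le_trans (integral_osc n j) _; rewrite lee_fin.
apply: (@le_trans _ _ ((T * `|W n| + 1) * r j `^ b)); first by rewrite ler_wpM2r ?powR_ge0.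
by rewrite mulrC -ler_pdivlMr// ltW.
Qed.

(** The smaller ball lies in the larger one, which lies in the fourfold dilate of the smaller. So
    both deviations can be compared on the smaller ball, at the price of [C ^+ 2] for the volume of
    the larger. *)
Let ball_constant_step q q' j y : good q j -> good q' j.+1 ->
  d q y < r j / 4 -> d q' y < r j.+1 / 4 ->
  `|a q' j.+1 - a q j| <= A0 * T * (r j `^ b - r j.+1 `^ b).
Proof.
move=> gq gq' qy qy'.
have rj := r0 j; have rj1 := r0 j.+1.
have sub : dball d q' (r j.+1) `<=` dball d q (r j).
  move=> x; rewrite /dball /= => q'x.
  have := is_metric_triangle dM q' q x; have := is_metric_triangle dM y q q'.
  rewrite (is_metric_sym dM y q'); rewrite rS in qy' q'x; lra.
have vv : v q (r j) <= C ^+ 2 * v q' (r j.+1).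
  apply: le_trans (volume_doubling_iter C0 vD _ 2 _) => //.
  apply: (volume_le dM bd mv) => //; first by rewrite mulr_gt0.
  move=> x; rewrite /dball /= => qx.
  have := is_metric_triangle dM q q' x; have := is_metric_triangle dM y q' q.
  rewrite (is_metric_sym dM y q) expr2 rS; rewrite rS in qy'; lra.
have v'0 := v0 q' rj1.
have mB q1 i : measurable (dball d q1 (r i)) by exact: measurable_dball.
have : (`|a q' j.+1 - a q j|%:E * m (dball d q' (r j.+1)) <=
   \int[m]_(x in dball d q' (r j.+1)) `|f x - (a q' j.+1)%:E| +
   \int[m]_(x in dball d q (r j)) `|f x - (a q j)%:E|)%E.
  apply: (@le_trans _ _ (\int[m]_(x in dball d q' (r j.+1)) `|f x - (a q' j.+1)%:E| +
   \int[m]_(x in dball d q' (r j.+1)) `|f x - (a q j)%:E|)%E); last first.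
    by apply: leeD2l; apply: nnintegral_subset.
  rewrite -integral_cst// -ge0_integralD//; last 2 first.
  - exact: measurable_funTS.
  - exact: measurable_funTS.
  apply: le_nnintegral => //; [exact: emeasurable_funD|by move=> x; rewrite /= lee_fin|].
  move=> x _ /=; case: (f x) => [t| |]; rewrite ?leey//.
  rewrite -!EFinB /= -EFinD lee_fin.
  have -> : a q' j.+1 - a q j = (t - a q j) - (t - a q' j.+1) by ring.
  by rewrite [leRHS]addrC ler_normB.
move=> /le_trans/(_ (leeD (Hgood gq') (Hgood gq))); rewrite mv// -EFinM -EFinD lee_fin.
move=> H.
have rp : r j.+1 `^ b <= r j `^ b.
  by rewrite rpow_step ler_piMl ?powR_ge0// ltW.
have -> : A0 * T * (r j `^ b - r j.+1 `^ b) = T * (1 + C ^+ 2) * r j `^ b.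
  rewrite rpow_step /A0; field.
  by rewrite subr_eq0 eq_sym lt_eqF.
rewrite -(ler_pM2r v'0); apply: le_trans H _.
have : T * r j.+1 `^ b * v q' (r j.+1) <= T * r j `^ b * v q' (r j.+1).
  by rewrite ler_wpM2r ?(ltW v'0)// ler_wpM2l.
have : T * r j `^ b * v q (r j) <= T * r j `^ b * (C ^+ 2 * v q' (r j.+1)).
  by rewrite ler_wpM2l// mulr_ge0 ?powR_ge0.
set P := r j `^ b; set Q := v q' _; move=> H1 H2.
have -> : T * (1 + C ^+ 2) * P * Q = T * P * Q + T * P * (C ^+ 2 * Q) by ring.
lra.
Qed.

(** A chain of good balls near [y] leads from scale [i] to a scale [j] where [osc] is small at [y].
    The deviation of [f y] from the last ball constant is one summand of [osc], so no
    differentiation theorem enters. *)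
Let value_near_ball_constant n i q y : goodset y -> d x0 y < n.+1%:R ->
  (forall (e : R) i, 0 < e -> exists2 j, (i <= j)%N & (osc n j y < e%:E)%E) ->
  q \in S n i -> d q y < r i / 4 ->
  (`|f y - (a q i)%:E| <= (A0 * T * r i `^ b)%:E)%E.
Proof.
move=> yG yn small qS qy.
have g_of j q' : q' \in S n j -> d q' y < r j / 4 -> good q' j.
  move=> q'S q'y; apply: (yG n j q') => //; have := r0 j; lra.
have chain k : exists2 q', q' \in S n (i + k)%N & d q' y < r (i + k)%N / 4 /\
    `|a q' (i + k)%N - a q i| <= A0 * T * (r i `^ b - r (i + k)%N `^ b).
  elim: k => [|k [q' q'S [q'y IH]]].
    by rewrite addn0; exists q => //; split => //; rewrite !subrr normr0 mulr0.
  rewrite addnS; have [q2 q2S q2y] := Snet (i + k).+1 yn.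
  have q2y' : d q2 y < r (i + k).+1 / 4 by have := r0 (i + k).+1; lra.
  exists q2 => //; split => //.
  have := ball_constant_step (g_of _ _ q'S q'y) (g_of _ _ q2S q2y') q'y q2y'.
  have := ler_distD (a q' (i + k)%N) (a q2 (i + k).+1) (a q i).
  move: IH; set X1 := `|_|; set X2 := `|_|; set X3 := `|_|.
  rewrite !mulrBr; lra.
apply/lee_addgt0Pr => e e0.
have [j ij oj] := small e i e0.
have [q' q'S [q'y]] := chain (j - i)%N; rewrite (subnKC ij) in q'S q'y * => H.
have gq' := g_of _ _ q'S q'y.
have : (`|f y - (a q' j)%:E| <= osc n j y)%E.
  rewrite /osc (perm_big _ (perm_to_rem q'S)) big_cons gq' patchE mem_set; last first.
    by rewrite /dball /=; have := r0 j; lra.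
  by rewrite leeDl// sume_ge0.
move=> /le_lt_trans/(_ oj); case: (f y) => [t| |]//.
rewrite -!EFinB /= lte_fin -EFinD lee_fin => H2.
have := ler_distD (a q' j) t (a q i).
have : 0 <= A0 * T * r j `^ b by rewrite mulr_ge0 ?powR_ge0// mulr_ge0.
move: H H2; rewrite mulrBr; set X1 := `|_|; set X2 := `|_|; set X3 := `|_|; lra.
Qed.

(** Points closer than [r i / 8] lie near the centre of a common net ball, so both values are close
    to its constant; [i] is then taken with [r i] comparable to the distance. *)
Lemma hoelder_on_goodset : exists2 N : set X, m.-negligible N &
  forall x y, goodset x -> goodset y -> ~ N x -> ~ N y -> d x y < 8^-1 ->
    (`|f x - f y| <= (32 * A0 * T * d x y `^ b)%:E)%E.
Proof.
exists (\bigcup_n [set y | ~ forall (e : R) i, 0 < e ->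
     exists2 j, (i <= j)%N & (osc n j y < e%:E)%E]).
  by apply: negligible_bigcup.
move=> x y xG yG xN yN xy.
have [b0 b1] := andP b01.
have [n [xn yn]] : exists n : nat, d x0 x < n.+1%:R /\ d x0 y < n.+1%:R.
  exists (Num.truncn (Num.max (d x0 x) (d x0 y))).
  have := truncnS_gt (Num.max (d x0 x) (d x0 y)).
  by rewrite gt_max => /andP.
have {}xN : forall (e : R) i, 0 < e -> exists2 j, (i <= j)%N & (osc n j x < e%:E)%E.
  by apply: contrapT => H; apply: xN; exists n.
have {}yN : forall (e : R) i, 0 < e -> exists2 j, (i <= j)%N & (osc n j y < e%:E)%E.
  by apply: contrapT => H; apply: yN; exists n.
have both i : d x y < r i / 8 -> (`|f x - f y| <= (2 * A0 * T * r i `^ b)%:E)%E.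
  move=> xyi; have [q qS qx] := Snet i xn; have ri := r0 i.
  have := @value_near_ball_constant n i q x xG xn xN qS.
  have := @value_near_ball_constant n i q y yG yn yN qS.
  have -> : d q x < r i / 4 by lra.
  have -> : d q y < r i / 4 by have := is_metric_triangle dM x q y; lra.
  move=> /(_ isT) + /(_ isT).
  case: (f x) => [s| |]; case: (f y) => [t| |]//; rewrite -!EFinB /= !lee_fin.
  have := ler_distD (a q i) s t; rewrite (distrC t).
  set X1 := `|_|; set X2 := `|_|; set X3 := `|_|.
  have -> : 2 * A0 * T * r i `^ b = A0 * T * r i `^ b + A0 * T * r i `^ b by ring.
  lra.
(* Even for [x = y] something is to be shown: [f x] must be finite, as the difference of two equal
   infinite values is infinite in modulus. *)
have [xy0|xyn0] := eqVneq (d x y) 0.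
  have -> : x = y by case: dM => _ /(_ x y)[/(_ xy0)].
  rewrite is_metric_xx// powR0 ?gt_eqF// mulr0.
  have := both 0%N; rewrite xy0 divr_gt0// => /(_ isT).
  have : f y \is a fin_num.
    have [q qS qy] := Snet 0 yn; have := r0 0 => r00.
    have := @value_near_ball_constant n 0 q y yG yn yN qS.
    have -> : d q y < r 0 / 4 by lra.
    by move=> /(_ isT); case: (f y).
  by move=> /fineK <-; rewrite -EFinB subrr abse0.
have xyp : 0 < d x y by rewrite lt_neqAle eq_sym xyn0 is_metric_ge0.
have [i [ri1 ri2]] : exists i, r i.+1 / 8 <= d x y /\ d x y < r i / 8.
  have exP : exists i, r i / 8 <= d x y.
    have [k kd] : exists k : nat, (d x y)^-1 <= k%:R.
      by exists (Num.truncn (d x y)^-1).+1; apply/ltW/truncnS_gt.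
    exists k; rewrite /r exprVn ler_pdivrMr//.
    apply: (@le_trans _ _ (d x y)); last by rewrite ler_peMr ?(ltW xyp)// ler1n.
    rewrite -[leRHS]invrK lef_pV2 ?posrE ?invr_gt0 ?exprn_gt0//.
    by apply: le_trans kd _; rewrite -natrX ler_nat; exact/ltnW/ltn_expl.
  case: (ex_minnP exP) => -[|i] iP imin.
    by move: iP; rewrite /r expr0 mul1r leNgt xy.
  exists i; split => //; rewrite ltNge; apply/negP => /imin.
  by rewrite ltnn.
apply: le_trans (both i ri2) _; rewrite lee_fin.
have -> : 32 * A0 * T * d x y `^ b = 2 * A0 * T * (16 * d x y `^ b) by ring.
apply: ler_wpM2l; first by rewrite mulr_ge0// mulr_ge0.
apply: (@le_trans _ _ ((16 * d x y) `^ b)).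
  apply: ge0_ler_powR; rewrite ?nnegrE ?mulr_ge0 ?(ltW b0) ?(ltW (r0 i))//; first exact: ltW.
  rewrite rS in ri1; lra.
rewrite powRM ?(ltW xyp)// ler_wpM2r ?powR_ge0//.
by apply: ler1_powR => //; rewrite ler1n.
Qed.

End HoelderOnGoodSet.

(** Putting the value [K] into the set of which the infimum is taken truncates the extension from
    above and keeps that set nonempty even if [G] is empty. The lemma is meant for [e] a multiple of
    a power of the distance. *)
Lemma mcshane_extension (R : realType) (X : Type) (e : X -> X -> R)
    (G : set X) (h : X -> R) (K : R) :
  (forall x y, 0 <= e x y) -> (forall x, e x x = 0) -> (forall x y, e x y = e y x) ->
  (forall x y z, e x z <= e x y + e y z) ->
  0 <= K -> (forall y, G y -> `|h y| <= K) ->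
  (forall x y, G x -> G y -> `|h x - h y| <= e x y) ->
  exists u : X -> R, [/\ forall x y, `|u x - u y| <= e x y,
    forall x, `|u x| <= K & forall x, G x -> u x = h x].
Proof.
move=> e0 exx esym etri K0 hK hL.
pose U x := [set t | t = K \/ exists2 y, G y & t = h y + e x y].
have UK x : U x K by left.
have Ulb x t : U x t -> - K <= t.
  move=> [->|[y Gy ->]]; first by lra.
  by have := hK y Gy; rewrite ler_norml => /andP[+ _]; have := e0 x y; lra.
have hU x : has_lbound (U x) by exists (- K) => t /Ulb.
have Ule x y : inf (U x) <= inf (U y) + e x y.
  rewrite -lerBlDr; apply: lb_le_inf; first by exists K.
  move=> t [->|[z Gz ->]]; rewrite lerBlDr.
    by apply: le_trans (ge_inf (hU x) (UK x)) _; rewrite lerDl.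
  apply: (@le_trans _ _ (h z + e x z)); first by apply: ge_inf => //; right; exists z.
  by rewrite -addrA lerD2l addrC.
exists (fun x => inf (U x)); split=> [x y|x|x Gx].
- rewrite ler_norml; apply/andP; split.
    by have := Ule y x; rewrite esym; lra.
  by have := Ule x y; lra.
- rewrite ler_norml; apply/andP; split.
    by apply: lb_le_inf; [exists K|move=> t /Ulb].
  exact: ge_inf.
- apply/eqP; rewrite eq_le; apply/andP; split.
    by apply: ge_inf => //; right; exists x; rewrite // exx addr0.
  apply: lb_le_inf; first by exists K.
  move=> t [->|[y Gy ->]].
    by have := hK x Gx; rewrite ler_norml => /andP[].
  by have := hL x y Gx Gy; rewrite ler_norml => /andP[_]; lra.
Qed.

(** * Upper gradients of [u] and [f - u] that use the set where the functions differ *)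

Section Gluing.
Context (R : realType) (disp : measure_display) (X : measurableType disp).
Variables (d : X -> X -> R) (mu : {measure set X -> \bar R}).
Variable Gs : set (@dpath R disp X).
Hypotheses (dM : is_metric d) (bd : borel_wrt_d d) (mu0 : non_atomic mu)
  (GsG : Gs `<=` Gamma_mu d mu) (subG : subpath_closed Gs).
Local Open Scope ereal_scope.

Lemma Gamma_mu_measurable_Im g : Gs g -> measurable (Defs.Im g).
Proof. by move=> /GsG[ok _ _ _]; exact: measurable_Im ok. Qed.

Lemma lint_restrict_le (g : @dpath R disp X) s t w : path_ok d g -> borel_nonneg w ->
  (pa g <= s)%R -> (s <= t)%R -> (t <= pb g)%R ->
  lint mu (Defs.restrict g s t) w <= lint mu g w.
Proof.
move=> ok [mw w0] as_ st tb; apply: nnintegral_subset => //.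
- by apply: (measurable_Im dM bd); apply: path_ok_restrict.
- exact: measurable_Im ok.
move=> _ [r rr <-]; exists r => //; move: rr.
rewrite /pdom /= !in_itv/= => /andP[sr rt].
by rewrite (le_trans as_ sr) (le_trans rt tb).
Qed.

Lemma ug_ineq_restrict (F w : X -> \bar R) g s t :
  (forall g, Gs g -> ug_ineq mu F w g) -> (forall x, 0 <= w x) -> Gs g ->
  (pa g <= s)%R -> (s <= t)%R -> (t <= pb g)%R ->
  F (pf g s) \is a fin_num -> F (pf g t) \is a fin_num ->
  `|F (pf g s) - F (pf g t)| <= lint mu (Defs.restrict g s t) w.
Proof.
(* The family is closed only under nontrivial subpaths, so [s = t] is treated apart. *)
move=> H w0 Gg as_ + tb; rewrite le_eqVlt => /orP[/eqP<- Fs _|st Fs Ft].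
  by rewrite subee// abse0; apply: integral_ge0.
exact: (H (Defs.restrict g s t) (subG Gg (conj as_ (conj st tb)))).
Qed.

Variables (f rho : X -> \bar R) (u : X -> R) (L : R).
Hypotheses (mf : measurable_fun setT f) (mu_ : measurable_fun setT u)
  (L0 : (0 <= L)%R) (brho : borel_nonneg rho)
  (fug : forall g, Gs g -> ug_ineq mu f rho g)
  (uug : forall g, Gs g -> ug_ineq mu (EFin \o u) (cst L%:E) g).

Let A : set X := [set x | f x != (u x)%:E].

Lemma measurable_disagreement : measurable A.
Proof.
have mB : measurable_fun setT (fun x => f x - (u x)%:E).
  by apply: emeasurable_funB => //; exact: measurableT_comp.
have -> : A = setT `&` [set x | f x - (u x)%:E != 0].
  rewrite setTI; apply/seteqP; split => x /=; apply: contra => /eqP.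
    by case: (f x) => [t| |]//; rewrite -EFinB => -[/subr0_eq->].
  by move=> ->; rewrite subee.
exact: emeasurable_neq.
Qed.
Let mA := measurable_disagreement.

Let w := fun x => rho x + L%:E.
Let bL : borel_nonneg (cst L%:E : X -> \bar R).
Proof. by split => // x; rewrite /= lee_fin. Qed.
Let bw : borel_nonneg w.
Proof.
by case: brho => mr r0; split=> [|x]; [exact: emeasurable_funD|rewrite adde_ge0 ?lee_fin].
Qed.

Let lint_w g : measurable (Defs.Im g) ->
  lint mu g w = lint mu g rho + lint mu g (cst L%:E).
Proof.
move=> mg; case: brho => mr r0; rewrite /lint ge0_integralD//.
exact: measurable_funTS.
Qed.

Let agree x : ~ A x -> f x = (u x)%:E.
Proof. by move=> /negP; rewrite negbK => /eqP. Qed.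

(** At points outside [A] the difference vanishes, so cutting there leaves two end pieces, which
    [lint_end_pieces] confines to [A]; its limit needs the finite integral. A path inside [A] only
    needs the sum of the two upper gradient inequalities. *)
Lemma ug_ineq_difference g : Gs g -> lint mu g rho < +oo ->
  ug_ineq mu (fun x => f x - (u x)%:E) (w \_ A) g.
Proof.
move=> Gg fin; have [ok nt inj mupos] := GsG Gg.
have mg := Gamma_mu_measurable_Im Gg.
have ab : (pa g <= pb g)%R by exact: ltW.
have u_sub s t := @ug_ineq_restrict (EFin \o u) (cst L%:E) g s t uug bL.2 Gg.
have f_sub s t := @ug_ineq_restrict f rho g s t fug brho.2 Gg.
have lintL : lint mu g (cst L%:E) < +oo.
  rewrite /lint integral_cst//; have /andP[_ mf_] := mupos _ _ (conj (lexx _) (conj nt (lexx _))).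
  by rewrite lte_mul_pinfty// ?lee_fin.
move=> /= ha hb.
have fa : f (pf g (pa g)) \is a fin_num by move: ha; case: (f (pf g (pa g))).
have fb : f (pf g (pb g)) \is a fin_num by move: hb; case: (f (pf g (pb g))).
rewrite /lint -integral_mkcondr.
have fuD s t : (pa g <= s)%R -> (s <= t)%R -> (t <= pb g)%R ->
    f (pf g s) \is a fin_num -> f (pf g t) \is a fin_num ->
    `|(f (pf g s) - (u (pf g s))%:E) - (f (pf g t) - (u (pf g t))%:E)| <=
    lint mu (Defs.restrict g s t) w.
  move=> as_ st tb fs ft; rewrite lint_w; last first.
    by apply: (measurable_Im dM bd); apply: path_ok_restrict.
  apply: le_trans (leeD (f_sub s t as_ st tb fs ft) (u_sub s t as_ st tb isT isT)).
  rewrite /comp; move: (f (pf g s)) (f (pf g t)) fs ft => [F1| |]// [F2| |]// _ _.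
  rewrite -!EFinB /= -EFinD lee_fin; set u1 := u _; set u2 := u _.
  have -> : ((F1 - u1) - (F2 - u2) = (F1 - F2) - (u1 - u2))%R by ring.
  exact: ler_normB.
have [zero|nozero] := pselect (exists2 t, pdom g t & ~ A (pf g t)); last first.
  rewrite setIidl; first exact: fuD.
  move=> _ [t tab <-]; apply: contrapT => At; apply: nozero; exists t => //.
apply: (lint_end_pieces dM bd mu0 ok inj bw) => //.
  by rewrite lint_w// lte_add_pinfty.
move=> z z'; rewrite /pdom /= !in_itv/= => /andP[az zb] /andP[az' zb'] zz' Az Az'.
have fz : f (pf g z) \is a fin_num by rewrite (agree Az).
have fz' : f (pf g z') \is a fin_num by rewrite (agree Az').
have := fuD (pa g) z (lexx _) az zb fa fz.
have := fuD z' (pb g) az' zb' (lexx _) fz' fb.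
rewrite (agree Az) (agree Az') !subee// sube0 sub0e abseN => H1 H2.
apply: le_trans (leeD H2 H1).
exact: lee_abs_sub.
Qed.

(** A constant need not be in L^p, so [u] requires an upper gradient that uses the constant on [A]
    only. Between two points of agreement [u] changes as [f] does and [rho] suffices; the constant
    serves the end pieces. *)
Lemma ug_ineq_glued g : Gs g ->
  ug_ineq mu (EFin \o u) (fun x => rho x + ((cst L%:E) \_ A) x) g.
Proof.
move=> Gg; have [ok nt inj mupos] := GsG Gg.
have mg := Gamma_mu_measurable_Im Gg.
have ab : (pa g <= pb g)%R by exact: ltW.
case: (brho) => mr r0.
have u_sub s t := @ug_ineq_restrict (EFin \o u) (cst L%:E) g s t uug bL.2 Gg.
have f_sub s t := @ug_ineq_restrict f rho g s t fug brho.2 Gg.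
have lintL : lint mu g (cst L%:E) < +oo.
  rewrite /lint integral_cst//; have /andP[_ mf_] := mupos _ _ (conj (lexx _) (conj nt (lexx _))).
  by rewrite lte_mul_pinfty// ?lee_fin.
move=> _ _.
have rest0 x : 0 <= (cst L%:E \_ A) x by rewrite patchE; case: ifP => //; rewrite lee_fin.
rewrite /lint ge0_integralD//; last 2 first.
- exact: measurable_funTS.
- by apply: measurable_funTS; apply/(measurable_restrictT _ _).1.
rewrite -/(lint mu g rho) -integral_mkcondr.
have rg0 : 0 <= lint mu g rho by apply: integral_ge0.
have [zero|nozero] := pselect (exists2 t, pdom g t & ~ A (pf g t)); last first.
  rewrite setIidl; last first.
    by move=> _ [t tab <-]; apply: contrapT => At; apply: nozero; exists t.
  by apply: le_trans (uug Gg isT isT) _; rewrite leeDr.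
(* Once finite, the integral of [rho] moves to the left, and the difference becomes the [kappa] of
   [lint_end_pieces]. *)
have [roo|rfin] := eqVneq (lint mu g rho) +oo.
  by rewrite roo addye ?leey// gt_eqF// (lt_le_trans ltNy0)// integral_ge0.
have {}rfin : lint mu g rho \is a fin_num by rewrite ge0_fin_numE// ltey.
rewrite addeC -leeBlDr//.
apply: (lint_end_pieces dM bd mu0 ok inj bL) => //.
move=> z z'; rewrite /pdom /= !in_itv/= => /andP[az zb] /andP[az' zb'] zz' Az Az'.
have H1 := u_sub (pa g) z (lexx _) az zb isT isT.
have H3 := u_sub z' (pb g) az' zb' (lexx _) isT isT.
have H2 : `|(u (pf g z))%:E - (u (pf g z'))%:E| <= lint mu g rho.
  rewrite -(agree Az) -(agree Az').
  apply: le_trans (f_sub z z' az zz' zb' _ _) _; rewrite ?(agree Az) ?(agree Az')//.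
  by apply: lint_restrict_le.
rewrite leeBlDr//; apply: le_trans (leeD (leeD H1 H3) H2).
rewrite /comp -!EFinB /= -!EFinD lee_fin.
have := ler_distD (u (pf g z)) (u (pf g (pa g))) (u (pf g (pb g))).
have := ler_distD (u (pf g z')) (u (pf g z)) (u (pf g (pb g))).
lra.
Qed.

End Gluing.

(** * Arc-chord estimate, mean oscillation on good balls, and truncation of [f] *)

Lemma le_diam (R : realType) (disp : measure_display) (X : measurableType disp)
    (d : X -> X -> R) (A : set X) x y : A x -> A y -> ((d x y)%:E <= diam d A)%E.
Proof. by move=> Ax Ay; apply: ereal_sup_ubound; exists (x, y). Qed.

Lemma hoelder_ug_ineq (R : realType) (disp : measure_display)
    (X : measurableType disp) (d : X -> X -> R) (mu : {measure set X -> \bar R})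
    (Gs : set (@dpath R disp X)) (u : X -> R) (L b c : R) :
  is_metric d -> borel_wrt_d d -> Gs `<=` Gamma_mu d mu -> 0 <= b -> 0 <= L ->
  (forall g, Gs g -> (diam d (Defs.Im g) `^ b <= c%:E * mu (Defs.Im g))%E) ->
  (forall x y, `|u x - u y| <= L * d x y `^ b) ->
  forall g, Gs g -> ug_ineq mu (EFin \o u) (cst (L * c)%:E) g.
Proof.
move=> dM bd GsG b0 L0 Hc uL g Gg _ _; have [ok nt _ _] := GsG _ Gg.
rewrite /lint integral_cst; last exact: measurable_Im ok.
rewrite -EFinB /= EFinM -muleA.
apply: (@le_trans _ _ (L%:E * (d (pf g (pa g)) (pf g (pb g)) `^ b)%:E)%E).
  by rewrite -EFinM lee_fin.
apply: lee_wpmul2l => //; apply: le_trans (Hc _ Gg).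
rewrite -poweR_EFin; apply: le_poweR => //; first by rewrite lee_fin is_metric_ge0.
apply: le_diam; [exists (pa g)|exists (pb g)] => //;
by rewrite /pdom /= in_itv/= lexx ?(ltW nt).
Qed.

Section BallConstants.
Context (R : realType) (disp : measure_display) (X : measurableType disp).
Variables (d : X -> X -> R) (m : {measure set X -> \bar R}).
Hypotheses (dM : is_metric d) (bd : borel_wrt_d d).
Local Open Scope ereal_scope.

Lemma diam_dball x r : diam d (dball d x r) <= (2 * r)%:E.
Proof.
apply: ge_ereal_sup => _ [[y z] /= []] /= xy xz <-; rewrite lee_fin /=.
move: xy xz; rewrite /dball/= => xy xz.
by have := is_metric_triangle dM x y z; rewrite (is_metric_sym dM y x); lra.
Qed.

(** Pointwise [|f|] is at most 1 plus its p-th power, and [D] has finite measure. *)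
Lemma in_Lp_integrable (p : R) (f : X -> \bar R) (D : set X) : (1 <= p)%R ->
  measurable D -> m D < +oo -> in_Lp m p f -> m.-integrable D f.
Proof.
move=> p1 mD fD [mf fp]; apply/integrableP; split; first exact: measurable_funTS.
have mfp : measurable_fun setT (fun x => `|f x| `^ p).
  by apply: measurable_poweR_comp; exact: measurableT_comp.
apply: (@le_lt_trans _ _ (\int[m]_(x in D) (1 + `|f x| `^ p))).
  apply: le_nnintegral => //; first exact: measurableT_comp.
    exact: emeasurable_funD.
  move=> x _; have := abse_ge0 (f x); case: (`|f x|) => [t|_|//]; last first.
    by rewrite poweRyr ?addey// gt_eqF// (lt_le_trans ltr01).
  rewrite lee_fin => t0; rewrite poweR_EFin -EFinD lee_fin.
  have [t1|t1] := leP t 1%R; first by have := powR_ge0 t p; lra.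
  by have := le1r_powR (ltW t1) p1; lra.
rewrite ge0_integralD//; last 2 first.
- by move=> x _; exact: poweR_ge0.
- exact: measurable_funTS.
rewrite integral_cst// mul1e lte_add_pinfty//.
by apply: le_lt_trans fp; apply: nnintegral_subset => // x; exact: poweR_ge0.
Qed.

Lemma poincare_good_ball (p b c lam K : R) (f rho : X -> \bar R) (x : X) (r V V' : R) :
  (1 <= p)%R -> (0 < b <= 1)%R -> (0 < c)%R -> (0 <= K)%R -> (0 < r)%R ->
  (0 < V)%R -> (0 < V')%R ->
  m (dball d x r) = V%:E -> m (dball d x (lam * r)) = V'%:E ->
  in_Lp m p f -> borel_nonneg rho ->
  (avg m (dball d x r) (fun y => `| f y - avg m (dball d x r) f |)
      <= c%:E * (diam d (dball d x r) `^ b)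
         * (avg m (dball d x (lam * r)) (fun y => rho y `^ p)) `^ (p^-1)%R) ->
  \int[m]_(y in dball d x (lam * r)) (rho y `^ p) <= (K `^ p)%R%:E * V'%:E ->
  \int[m]_(y in dball d x r) `|f y - (fine (avg m (dball d x r) f))%:E| <=
     (2 * c * K * r `^ b * V)%:E.
Proof.
move=> p1 /andP[b0 b1] c0 K0 r0 V0 V'0 mV mV' Lf br H good.
have p0 : (0 < p)%R by exact: lt_le_trans p1.
have mB := measurable_dball dM bd x r.
have ifB : m.-integrable (dball d x r) f by apply: (in_Lp_integrable p1) => //; rewrite mV ltry.
have avgfin : avg m (dball d x r) f \is a fin_num.
  by rewrite /avg fin_numM// integrable_fin_num.
rewrite fineK//.
have : avg m (dball d x r) (fun y => `| f y - avg m (dball d x r) f |) <=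
    (2 * c * K * r `^ b)%:E.
  apply: le_trans H _.
  have -> : (2 * c * K * r `^ b)%:E = c%:E * (2 * r `^ b)%:E * K%:E.
    by rewrite -!EFinM; congr EFin; ring.
  apply: lee_pmul => //; rewrite ?mule_ge0 ?poweR_ge0 ?lee_fin ?(ltW c0)//.
    apply: lee_wpmul2l; first by rewrite lee_fin ltW.
    apply: (@le_trans _ _ ((2 * r)%:E `^ b)).
      apply: le_poweR; [exact: ltW| |exact: diam_dball].
      apply: (@le_trans _ _ (d x x)%:E); first by rewrite lee_fin is_metric_ge0.
      by apply: le_diam; rewrite /dball/= is_metric_xx.
    rewrite poweR_EFin lee_fin powRM// ?(ltW r0)// ler_wpM2r ?powR_ge0//.
    by apply: ler1_powR => //; rewrite ler1n.
  rewrite -[leRHS](@poweRVK _ p) ?lee_fin//; apply: le_poweR.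
  - by rewrite invr_ge0 ltW.
  - rewrite /avg mule_ge0 ?lee_fin ?invr_ge0 ?fine_ge0//.
    by apply: integral_ge0 => y _; exact: poweR_ge0.
  rewrite /avg mV' /= -(@lee_pmul2l _ V'%:E)//.
  by rewrite muleA -EFinM divff ?gt_eqF// mul1e [leRHS]muleC.
rewrite {1}/avg mV /= => H2.
rewrite -(@lee_pmul2l _ (V^-1)%:E) ?lte_fin ?invr_gt0//.
apply: le_trans H2 _; rewrite -EFinM lee_fin mulrCA mulVf ?mulr1//.
by rewrite gt_eqF.
Qed.

End BallConstants.

(** [u] extends [f] from the points outside the bad balls, a null set and the set where [|f|]
    exceeds [K]. The bad balls contribute [2 * C ^+ 2] by the weak-type bound and the large values
    contribute 1 by Chebyshev. [L] does not depend on [K]. *)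
Lemma hoelder_truncation (R : realType) (disp : measure_display)
    (X : measurableType disp) (d : X -> X -> R) (m : {measure set X -> \bar R})
    (p b C : R) (v : X -> R -> R) (c lam : R) (f rho : X -> \bar R) :
  is_metric d -> borel_wrt_d d -> 0 < C ->
  (forall (x : X) (r : R), 0 < r -> m (dball d x r) = (v x r)%:E) ->
  (forall (x : X) (r : R), 0 < r -> 0 < v x r) ->
  (forall (x : X) (r : R), 0 < r -> v x (2 * r) <= C * v x r) ->
  1 <= p -> 0 < b <= 1 -> 0 < c -> 1 <= lam ->
  in_Lp m p f -> borel_nonneg rho ->
  (forall (x : X) (r : R), 0 < r ->
     (avg m (dball d x r) (fun y => `| f y - avg m (dball d x r) f |)
      <= c%:E * (diam d (dball d x r) `^ b)
         * (avg m (dball d x (lam * r)) (fun y => rho y `^ p)) `^ (p^-1)%R)%E) ->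
  exists2 L : R, 0 <= L & forall K : R, 0 < K -> exists u : X -> R,
    [/\ forall x y, `|u x - u y| <= L * K * d x y `^ b,
        forall x, `|u x| <= K &
        ((K `^ p)%R%:E * m [set x | f x != (u x)%:E] <= (2 * C ^+ 2 + 1)%:E *
           \int[m]_(x in [set x | (K `^ p / 2)%:E < rho x `^ p + `|f x| `^ p])
             (rho x `^ p + `|f x| `^ p))%E].
Proof.
move=> dM bd C0 mv v0 vD p1 b01 c0 lam1 Lf brho poin.
have [b0 b1] := andP b01; have p0 : 0 < p by exact: lt_le_trans p1.
have lam0 : 0 < lam by exact: lt_le_trans lam1.
case: (Lf) (brho) => mf _ [mrho rho0].
pose r i : R := 2^-1 ^+ i.
have r0 i : 0 < r i by rewrite exprn_gt0// invr_gt0.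
have r1 i : r i <= 1 by rewrite exprn_ile1 ?invr_ge0// invf_le1// ler1n.
have x0 : X by exact: point.
(* At spacing [r / 8] the disjoint balls have radius [r / 16]; four doublings reach [r], hence
   [C ^+ 4]. *)
have /choice[S_ HS] (ni : nat * nat) : exists S : seq X,
    (forall x, d x0 x < ni.1.+1%:R -> exists2 q, q \in S & d q x < r ni.2 / 8) /\
    \sum_(q <- S) v q (r ni.2) <= C ^+ 4 * v x0 (ni.1.+2%:R).
  case: ni => n i /=; have r80 : 0 < r i / 8 by rewrite divr_gt0.
  have n0 : 0 < n.+1%:R :> R by rewrite ltr0n.
  have [S [Snet SV]] := ball_net dM bd C0 mv v0 vD x0 n0 r80.
  exists S; split => //.
  apply: (@le_trans _ _ (\sum_(q <- S) C ^+ 4 * v q (r i / 8 / 2))).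
    apply: ler_sum => q _.
    apply: le_trans (volume_doubling_iter C0 vD _ 4 _); last by rewrite divr_gt0.
    by rewrite (_ : 2 ^+ 4 * _ = r i)//; field.
  rewrite -mulr_sumr; apply: ler_wpM2l; first by rewrite exprn_ge0// ltW.
  apply: le_trans SV _.
  apply: (volume_le dM bd mv); rewrite ?addr_gt0 ?ltr0n// => x.
  rewrite /dball /= => /lt_le_trans; apply; rewrite -[leRHS]natr1 lerD2l.
  by have := r1 i; have := r0 i; lra.
pose S n i := S_ (n, i).
pose A : R := (1 + C ^+ 2) / (1 - 2^-1 `^ b).
have A0 : 0 <= A.
  apply: divr_ge0; first by rewrite addr_ge0// exprn_ge0// ltW.
  rewrite subr_ge0 -{2}(powRr0 (2^-1 : R)); apply: ger_powR; rewrite ?(ltW b0)//.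
  by rewrite invr_gt0 ltr0n/= invf_le1// ler1n.
pose L := 32 * A * (2 * c) + 16.
have LA0 : 0 <= 32 * A * (2 * c).
  by apply: mulr_ge0; [exact: mulr_ge0|rewrite mulr_ge0// ltW].
have L0 : 0 <= L by exact: addr_ge0.
exists L => // K K0.
pose k := K `^ p; have k0 : 0 < k by rewrite powR_gt0.
have LK0 : 0 <= L * K by rewrite mulr_ge0// ltW.
pose good q i := `[< (\int[m]_(y in dball d q (lam * r i)) (rho y `^ p) <=
   k%:E * (v q (lam * r i))%:E)%E >].
pose a q i := fine (avg m (dball d q (r i)) f).
have lr0 i : 0 < lam * r i by rewrite mulr_gt0.
have Hgood q i : good q i -> (\int[m]_(x in dball d q (r i)) `|f x - (a q i)%:E| <=
       (2 * c * K * r i `^ b * v q (r i))%:E)%E.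
  move=> /asboolP gq; apply: (poincare_good_ball dM bd (V' := v q (lam * r i)) (p := p)
    (lam := lam) (rho := rho)) => //; rewrite ?v0// ?mv//; first exact: ltW.
  exact: poin.
have T0 : 0 <= 2 * c * K by rewrite mulr_ge0 ?(ltW K0)// mulr_ge0// ltW.
have [N negN HN] := @hoelder_on_goodset _ _ _ d m dM bd C v C0 mv v0 vD b b01 x0 S
  (fun n => C ^+ 4 * v x0 n.+2%:R) (fun n i => (HS (n, i)).1)
  (fun n i => (HS (n, i)).2) f a good _ mf T0 Hgood.
(* Coding pairs [(n, i)] by integers arranges the bad balls in one sequence of finite lists. The
   radius listed is that of the enlarged ball, on which the mean of [rho ^ p] is too large. *)
pose M j : seq (X * R) := if unpickle j is Some (n, i) then
  [seq (q, lam * r i) | q <- S n i & ~~ good q i] else [::].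
have mrp : measurable_fun setT (fun x => rho x `^ p)%E by exact: measurable_poweR_comp.
have mfp : measurable_fun setT (fun x => `|f x| `^ p)%E.
  by apply: measurable_poweR_comp; exact: measurableT_comp.
have mphi : measurable_fun setT (fun x => rho x `^ p + `|f x| `^ p)%E.
  exact: emeasurable_funD.
pose E := \bigcup_j ball_union d (M j).
have mE : measurable E by apply: bigcup_measurable => j _; exact: measurable_ball_union.
have Egood y : ~ E y -> goodset d S good y.
  move=> yE n i q qS qy; apply/negPn/negP => ng; apply: yE.
  exists (pickle (n, i)) => //; exists (q, lam * r i) => /=.
    by rewrite /M pickleK; apply/mapP; exists q => //; rewrite mem_filter ng.
  by rewrite /dball/=; apply: lt_le_trans qy _; rewrite ler_peMl ?(ltW (r0 i)).
have wE : (k%:E * m E <= (2 * C ^+ 2)%:E *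
    \int[m]_(x in [set x | (k / 2)%:E < rho x `^ p]) (rho x `^ p))%E.
  apply: (weak_type dM bd C0 mv vD) => //.
    by split => // x; exact: poweR_ge0.
  move=> j [q s]; rewrite /M; case: unpickle => [[n i]|//].
  move=> /mapP[q']; rewrite mem_filter => /andP[ng _] [-> ->] /=; split => //.
  by rewrite mv// ltNge; apply/negP => H; move/negP: ng; apply; apply/asboolP.
have [N' [mN' N'0 NN']] := negN.
pose F := [set x | (K%:E < `|f x|)%E].
have mF : measurable F.
  by rewrite -[F]setTI; apply: emeasurable_fun_o_infty => //; exact: measurableT_comp.
pose D := [set x | ((k / 2)%:E < rho x `^ p + `|f x| `^ p)%E].
have mD : measurable D by rewrite -[D]setTI; exact: emeasurable_fun_o_infty.
have phi0 x : (0 <= rho x `^ p + `|f x| `^ p)%E by rewrite adde_ge0// poweR_ge0.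
pose G := [set x | [/\ ~ E x, ~ N' x & ~ F x]].
have Gfin x : G x -> f x \is a fin_num /\ `|fine (f x)| <= K.
  move=> [_ _ /negP]; rewrite -leNgt.
  by case: (f x) => [t| |]//; rewrite lee_fin.
have d0 := is_metric_ge0 dM.
have GL x y : G x -> G y -> `|fine (f x) - fine (f y)| <= L * K * d x y `^ b.
  move=> Gx Gy; have [fx fxK] := Gfin x Gx; have [fy fyK] := Gfin y Gy.
  case: Gx Gy => Ex Nx Fx [Ey Ny Fy].
  have [xy|xy] := ltP (d x y) 8^-1.
    have := HN x y (Egood _ Ex) (Egood _ Ey) (fun H => Nx (NN' _ H)) (fun H => Ny (NN' _ H)) xy.
    rewrite -(fineK fx) -(fineK fy) -EFinB /= lee_fin => /le_trans; apply.
    rewrite ler_wpM2r ?powR_ge0// -/A /L mulrDl -subr_ge0.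
    rewrite (_ : _ - _ = 16 * K); first by rewrite mulr_ge0// ltW.
    by ring.
  apply: (@le_trans _ _ (K + K)); first by apply: le_trans (ler_normB _ _) _; rewrite lerD.
  have H : 1 <= 8 * d x y `^ b.
    apply: (@le_trans _ _ ((8 * d x y) `^ b)).
      apply: (@le_trans _ _ (1 `^ b)); first by rewrite powR1.
      apply: ge0_ler_powR; rewrite ?nnegrE ?mulr_ge0 ?(ltW b0)//.
      by rewrite -ler_pdivrMl// mulr1.
    by rewrite powRM// ler_wpM2r ?powR_ge0// ler1_powR// ler1n.
  apply: (@le_trans _ _ (16 * K * d x y `^ b)).
    rewrite (_ : 16 * K * _ = (K + K) * (8 * d x y `^ b)); last by ring.
    by rewrite ler_peMr// addr_ge0// ltW.
  by rewrite ler_wpM2r ?powR_ge0// ler_wpM2r ?(ltW K0)// lerDr.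
have [u [uL uK uG]] : exists u : X -> R, [/\ forall x y, `|u x - u y| <= L * K * d x y `^ b,
    forall x, `|u x| <= K & forall x, G x -> u x = fine (f x)].
  apply: mcshane_extension => //.
  - by move=> x y; rewrite mulr_ge0// powR_ge0.
  - by move=> x; rewrite is_metric_xx// powR0 ?mulr0// gt_eqF.
  - by move=> x y; rewrite (is_metric_sym dM).
  - move=> x y z; rewrite -mulrDr ler_wpM2l//.
    apply: le_trans (powR_subadditive b01 (d0 x y) (d0 y z)).
    apply: ge0_ler_powR; rewrite ?nnegrE ?addr_ge0 ?(ltW b0)//.
    exact: is_metric_triangle.
  - exact: ltW.
  - by move=> y /Gfin[].
exists u; split => //.
have mu_ : measurable_fun setT u := measurable_Hoelder bd dM b0 uL.
have sub : [set x | f x != (u x)%:E] `<=` E `|` (N' `|` F).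
  move=> x /= fu; apply: contrapT => H.
  have Gx : G x by split => Hx; apply: H; [left|right; left|right; right].
  by move/negP: fu; apply; rewrite uG// fineK//; have [] := Gfin x Gx.
apply: (@le_trans _ _ (k%:E * (m E + m F))%E).
  apply: lee_wpmul2l; first by rewrite lee_fin ltW.
  apply: (@le_trans _ _ (m (E `|` (N' `|` F)))).
    apply: le_measure; rewrite ?inE//; first exact: measurable_disagreement.
    by apply: measurableU => //; exact: measurableU.
  apply: le_trans (measureU2 _ _ _) _ => //; first exact: measurableU.
  apply: leeD2l; apply: le_trans (measureU2 _ _ _) _ => //.
  by rewrite [X in (X + _ <= _)%E](_ : _ = 0%E) ?add0e.
rewrite ge0_muleDr// EFinD ge0_muleDl ?lee_fin ?mulr_ge0 ?exprn_ge0 ?(ltW C0)//.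
apply: leeD.
  apply: le_trans wE _; apply: lee_wpmul2l.
    by rewrite lee_fin mulr_ge0// exprn_ge0// ltW.
  apply: (@le_trans _ _ (\int[m]_(x in D) (rho x `^ p))%E).
    apply: nnintegral_subset => //.
    - by rewrite -[X in measurable X]setTI; exact: emeasurable_fun_o_infty.
    - by move=> x; exact: poweR_ge0.
    - by move=> x /= H; apply: lt_le_trans H _; rewrite leeDl// poweR_ge0.
  apply: le_nnintegral => //; first by move=> x; exact: poweR_ge0.
  by move=> x _; rewrite leeDl// poweR_ge0.
have Fk x : F x -> (k%:E <= `|f x| `^ p)%E.
  move=> Fx; rewrite /k -poweR_EFin; apply: le_poweR; first exact: ltW.
    by rewrite lee_fin ltW.
  exact: ltW.
rewrite mul1e -integral_cst//; apply: (@le_trans _ _ (\int[m]_(x in F) (`|f x| `^ p))%E).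
  by apply: le_nnintegral => // x; rewrite /= lee_fin ltW.
apply: (@le_trans _ _ (\int[m]_(x in D) (`|f x| `^ p))%E).
  apply: nnintegral_subset => //; first by move=> x; exact: poweR_ge0.
  move=> x /Fk Hk; rewrite /D/=; apply: (@lt_le_trans _ _ k%:E).
    by rewrite lte_fin ltr_pdivrMr// ltr_pMr// ltr1n.
  by apply: le_trans Hk _; rewrite leeDr// poweR_ge0.
apply: le_nnintegral => //; first by move=> x; exact: poweR_ge0.
by move=> x _; rewrite leeDr// poweR_ge0.
Qed.

(** * Norms of functions restricted to a set *)

Section LpBounds.
Context (R : realType) (disp : measure_display) (X : measurableType disp).
Variable m : {measure set X -> \bar R}.
Local Open Scope ereal_scope.

Lemma Lnorm_le (p t : R) (h : X -> \bar R) : (0 < p)%R -> (0 <= t)%R ->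
  \int[m]_x (`|h x| `^ p) <= (t `^ p)%R%:E -> Lnorm m p%:E h <= t%:E.
Proof.
move=> p0 t0 H; rewrite unlock -[leRHS](@poweRVK _ p)// poweR_EFin.
apply: le_poweR => //; first by rewrite invr_ge0 ltW.
by apply: integral_ge0 => x _; exact: poweR_ge0.
Qed.

Lemma integral_poweR_patch (p : R) (A : set X) (w : X -> \bar R) : (0 < p)%R ->
  (forall x, 0 <= w x) ->
  \int[m]_x (`|(w \_ A) x| `^ p) = \int[m]_(x in A) (w x `^ p).
Proof.
move=> p0 w0; rewrite [RHS]integral_mkcond; apply: eq_integral => x _.
rewrite !patchE; case: ifP => _; first by rewrite gee0_abs.
by rewrite abse0 poweR0r// gt_eqF.
Qed.

Lemma measurable_patch (A : set X) (w : X -> \bar R) : measurable A ->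
  measurable_fun setT w -> measurable_fun setT (w \_ A).
Proof.
by move=> mA mw; apply/(measurable_restrictT _ _).1 => //; exact: measurable_funTS.
Qed.

Lemma borel_nonneg_patch (A : set X) (w : X -> \bar R) : measurable A ->
  borel_nonneg w -> borel_nonneg (w \_ A).
Proof.
move=> mA [mw w0]; split; first exact: measurable_patch.
by move=> x; rewrite patchE; case: ifP.
Qed.

End LpBounds.

(** * Choice of the height and estimate of the Newtonian norm *)

Theorem theorem5p4 (R : realType) (disp : measure_display)
  (X : measurableType disp) (d : X -> X -> R)
  (mu m : {measure set X -> \bar R}) (p beta : R) (Gs : set (@dpath R disp X)) :
  is_metric d -> borel_wrt_d d ->
  non_atomic mu -> doubling d m ->
  1 <= p -> 0 < beta <= 1 ->
  Gs `<=` Gamma_mu d mu -> subpath_closed Gs -> joins_points Gs ->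
  poincare d mu m Gs p beta -> arc_chord d mu Gs beta ->
  forall f : X -> \bar R, Ntilde mu m Gs p f ->
  forall eps : R, 0 < eps ->
  exists u : X -> R, exists L : R,
    [/\ forall x y, `|u x - u y| <= L * (d x y `^ beta),
        Ntilde mu m Gs p (fun x => (u x)%:E) &
        (N1p_norm mu m Gs p (fun x => (f x - (u x)%:E)%E) < eps%:E)%E].
Proof.
move=> dM bd mu0 dbl p1 b01 GsG subG _ [c [lam [c0 lam1 poin]]] [Cm Cm0 arc].
move=> f [Lf [rho1 [wug Lrho1]]] eps eps0.
have p0 : 0 < p by exact: lt_le_trans p1.
have b0 : 0 < beta by case/andP: b01.
have mG := Gamma_mu_measurable_Im dM bd GsG.
have [rho [brho Lrho ug]] := pweak_ug_upper_gradient p0 mG wug Lrho1.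
have [C [v [C0 mv v0 vD]]] := doubling_volume dbl.
case: (Lf) (brho) => mf fp [mrho rho0].
have rhop : (\int[m]_x (rho x `^ p) < +oo)%E.
  by case: Lrho => _; under eq_integral do rewrite gee0_abs//.
have poin' (x : X) (r : R) : 0 < r ->
     (avg m (dball d x r) (fun y => `| f y - avg m (dball d x r) f |)
      <= c%:E * (diam d (dball d x r) `^ beta)
         * (avg m (dball d x (lam * r)) (fun y => rho y `^ p)) `^ (p^-1)%R)%E.
  move=> r0; apply: poin => //.
    by apply: (in_Lp_integrable p1) => //; [exact: measurable_dball|rewrite mv// ltry].
  by split => // g Gg _; exact: ug.
have [L L0 HL] := hoelder_truncation dM bd C0 mv v0 vD p1 b01 c0 lam1 Lf brho poin'.
pose phi x := (rho x `^ p + `|f x| `^ p)%E.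
have mrp : measurable_fun setT (fun x => rho x `^ p)%E by exact: measurable_poweR_comp.
have mfp : measurable_fun setT (fun x => `|f x| `^ p)%E.
  by apply: measurable_poweR_comp; exact: measurableT_comp.
have phi0 x : (0 <= phi x)%E by rewrite adde_ge0// poweR_ge0.
have mphi : measurable_fun setT phi by exact: emeasurable_funD.
have iphi : (\int[m]_x phi x < +oo)%E.
  rewrite ge0_integralD//; first by rewrite lte_add_pinfty.
  - by move=> x _; exact: poweR_ge0.
  - by move=> x _; exact: poweR_ge0.
(* [K ^ p * m A] is at most [(2 * C ^+ 2 + 1) * del], and the integral of [phi] over [A] exceeds it
   by at most a tail below [del]. *)
pose c1 := 2 * C ^+ 2 + 2.
have c10 : 0 < c1 by rewrite ltr_wpDl// mulr_ge0// exprn_ge0// ltW.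
have Lp0 : 0 <= (L * Cm) `^ p by exact: powR_ge0.
have P0 : 0 < 2 `^ p :> R by rewrite powR_gt0.
pose Mc := 2 `^ p * (c1 * (2 + (L * Cm) `^ p)).
have Mc0 : 0 < Mc by rewrite !mulr_gt0// ltr_wpDr.
pose del := (eps / 3) `^ p / Mc.
have e30 : 0 < eps / 3 by rewrite divr_gt0.
have del0 : 0 < del by rewrite divr_gt0// powR_gt0.
have [N HN] := integral_tail_lt (conj mphi phi0) iphi del0.
(* This makes [K ^ p / 2] at least [N], from which on the tails of [phi] are below [del]. *)
pose K : R := (N%:R * 2 + 1) `^ p^-1.
have N10 : 0 < N%:R * 2 + 1 :> R by rewrite ltr_wpDl// mulr_ge0.
have K0 : 0 < K by rewrite powR_gt0.
have Kp : K `^ p = N%:R * 2 + 1 by rewrite -powRrM mulVf ?gt_eqF// powRr1// ltW.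
have {HN} /HN tail : N%:R <= K `^ p / 2 by rewrite Kp ler_pdivlMr// lerDl.
have [u [uL uK]] := HL K K0.
set A := [set x | f x != (u x)%:E]; move: tail.
set k := K `^ p; set D := [set x | _] => tail mAk.
have k0 : 0 < k by rewrite powR_gt0.
have mu_ : measurable_fun setT u := measurable_Hoelder bd dM b0 uL.
have mA : measurable A by exact: measurable_disagreement.
have mD : measurable D by rewrite -[D]setTI; exact: emeasurable_fun_o_infty.
have {}mAk : (k%:E * m A <= ((2 * C ^+ 2 + 1) * del)%:E)%E.
  apply: le_trans mAk _; rewrite EFinM; apply: lee_wpmul2l; last exact: ltW.
  by rewrite lee_fin addr_ge0// mulr_ge0// exprn_ge0// ltW.
have mAk' : (k%:E * m A <= (c1 * del)%:E)%E.
  by apply: le_trans mAk _; rewrite lee_fin ler_wpM2r ?(ltW del0)// lerD2l ler1n.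
have phiA : (\int[m]_(x in A) phi x <= (c1 * del)%:E)%E.
  apply: (@le_trans _ _ (\int[m]_(x in A) ((phi \_ D) x + k%:E))%E).
    apply: le_nnintegral => //.
      by apply: emeasurable_funD => //; exact: measurable_patch.
    move=> x _; rewrite patchE; case: ifPn => [_|].
      by rewrite leeDl// lee_fin ltW.
    rewrite notin_setE /D/= => /negP; rewrite -leNgt add0e => /le_trans; apply.
    by rewrite lee_fin ler_pdivrMr// ler_pMr// ler1n.
  rewrite ge0_integralD//; last 3 first.
  - by move=> x _; rewrite patchE; case: ifP.
  - by apply: measurable_funTS; exact: measurable_patch.
  - by move=> x _; rewrite lee_fin ltW.
  rewrite -integral_mkcondr integral_cst// (_ : c1 * del = del + (2 * C ^+ 2 + 1) * del); last first.
    by rewrite /c1; ring.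
  rewrite EFinD; apply: leeD => //; apply: le_trans (ltW tail).
  by apply: nnintegral_subset => //; exact: measurableI.
have rhoA : (\int[m]_(x in A) (rho x `^ p) <= (c1 * del)%:E)%E.
  apply: le_trans phiA; apply: le_nnintegral => //; first by move=> x; exact: poweR_ge0.
  by move=> x _; rewrite leeDl// poweR_ge0.
have fA : (\int[m]_(x in A) (`|f x| `^ p) <= (c1 * del)%:E)%E.
  apply: le_trans phiA; apply: le_nnintegral => //; first by move=> x; exact: poweR_ge0.
  by move=> x _; rewrite leeDr// poweR_ge0.
have cdel : 0 <= c1 * del by rewrite mulr_ge0// ltW.
have McE : Mc * del = (eps / 3) `^ p by rewrite mulrC divfK// gt_eqF.
have borel_cst (t : R) : 0 <= t -> borel_nonneg (cst t%:E : X -> \bar R).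
  by move=> t0; split => // x; rewrite /= lee_fin.
have cstA (t : R) :
    (\int[m]_(x in A) ((cst t%:E : X -> \bar R) x `^ p) = (t `^ p)%R%:E * m A)%E.
  by rewrite -integral_cst.
have babsf : borel_nonneg (fun x => `|f x|)%E by split => //; exact: measurableT_comp.
have mh : measurable_fun setT (fun x => f x - (u x)%:E)%E.
  by apply: emeasurable_funB => //; exact: measurableT_comp.
have hp : (\int[m]_x (`|f x - (u x)%:E| `^ p) <= ((eps / 3) `^ p)%R%:E)%E.
  rewrite (_ : \int[m]_x _ = \int[m]_(x in A) (`|f x - (u x)%:E| `^ p))%E; last first.
    rewrite [RHS]integral_mkcond; apply: eq_integral => x _; rewrite patchE.
    case: ifPn => //; rewrite notin_setE /A/= => /negP; rewrite negbK => /eqP->.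
    by rewrite subee// abse0 poweR0r// gt_eqF.
  apply: (@le_trans _ _ (\int[m]_(x in A) ((`|f x| + K%:E) `^ p)))%E.
    apply: le_nnintegral => //.
    - by apply: measurable_poweR_comp; exact: measurableT_comp.
    - apply: measurable_poweR_comp; apply: emeasurable_funD => //.
      exact: measurableT_comp.
    - by move=> x; exact: poweR_ge0.
    move=> x _; apply: le_poweR => //; first exact: ltW.
    by apply: le_trans (lee_abs_sub _ _) _; apply: leeD2l; rewrite lee_fin.
  apply: le_trans (integral_poweRD m (ltW p0) mA babsf (borel_cst K (ltW K0))) _.
  rewrite cstA -McE /Mc -[_ * _ * del]mulrA EFinM.
  apply: lee_wpmul2l; first by rewrite lee_fin ltW.
  apply: (@le_trans _ _ (c1 * del + c1 * del)%:E).
    by rewrite EFinD; apply: leeD.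
  rewrite lee_fin -subr_ge0 (_ : _ - _ = (L * Cm) `^ p * (c1 * del)); last by ring.
  exact: mulr_ge0.
pose L' := L * K * Cm.
have LK0 : 0 <= L * K by rewrite mulr_ge0// ltW.
have L'0 : 0 <= L' by rewrite mulr_ge0// ltW.
(* The constant gradient grows linearly in [K], so its p-th power over [A] is a fixed multiple of
   [k * m A], which is small. *)
have L'p : L' `^ p = (L * Cm) `^ p * k.
  rewrite /L' mulrAC [LHS]powRM; [by []|by apply: mulr_ge0 => //; exact: ltW|exact: ltW].
have uug := hoelder_ug_ineq dM bd GsG (ltW b0) LK0 arc uL.
pose w x := (rho x + L'%:E)%E.
have bw : borel_nonneg w.
  by split=> [|x]; [exact: emeasurable_funD|rewrite adde_ge0].
have wp : (\int[m]_x (`|(w \_ A) x| `^ p) <= ((eps / 3) `^ p)%R%:E)%E.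
  rewrite integral_poweR_patch//; last by case: bw.
  apply: le_trans (integral_poweRD m (ltW p0) mA brho (borel_cst L' L'0)) _.
  rewrite cstA -McE /Mc -[_ * _ * del]mulrA EFinM.
  apply: lee_wpmul2l; first by rewrite lee_fin ltW.
  apply: (@le_trans _ _ (c1 * del + (L * Cm) `^ p * (c1 * del))%:E).
    rewrite EFinD; apply: leeD => //.
    by rewrite L'p EFinM -muleA [leRHS]EFinM; apply: lee_wpmul2l => //; rewrite lee_fin.
  rewrite lee_fin -subr_ge0 (_ : _ - _ = c1 * del)//; ring.
have mAfin : (m A < +oo)%E.
  move: mAk; case: (m A) (measure_ge0 m A) => [t _ _||//]; first exact: ltry.
  by rewrite gt0_muley ?lte_fin.
exists u, (L * K); split => //.
  split.
    split; first exact: measurableT_comp.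
    apply: (@le_lt_trans _ _ (\int[m]_x ((`|f x| + `|f x - (u x)%:E|) `^ p)))%E.
      apply: le_nnintegral => //.
      - by apply: measurable_poweR_comp; do 2 apply: measurableT_comp => //.
      - apply: measurable_poweR_comp; apply: emeasurable_funD; exact: measurableT_comp.
      - by move=> x; exact: poweR_ge0.
      move=> x _; apply: le_poweR => //; first exact: ltW.
      case: (f x) => [t| |]//=; rewrite ?leey// -EFinD lee_fin.
      rewrite (_ : u x = t - (t - u x)); last by ring.
      by apply: le_trans (ler_normB _ _) _; rewrite opprB addrCA subrr addr0.
    apply: le_lt_trans (integral_poweRD m (ltW p0) measurableT babsf _) _.
      by split => //; exact: measurableT_comp.
    rewrite lte_mul_pinfty ?lee_fin ?powR_ge0// lte_add_pinfty//.
    by apply: le_lt_trans hp _; rewrite ltry.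
  have bLA := borel_nonneg_patch mA (borel_cst L' L'0).
  exists (fun x => rho x + ((cst L'%:E) \_ A) x)%E; split; last first.
    apply: in_LpD => //; first exact: ltW.
    split; first by case: bLA.
    rewrite integral_poweR_patch// cstA lte_mul_pinfty//.
    by rewrite lee_fin powR_ge0.
  split.
    split; first by apply: emeasurable_funD => //; case: bLA.
    by move=> x; rewrite adde_ge0//; case: bLA.
  (* The inequality holds along every path, so the exceptional family is empty. *)
  exists set0; split => //.
    by apply: (Modp_lint_infty p0 brho Lrho).
  by move=> g Gg _; exact: (ug_ineq_glued dM bd mu0 GsG subG mf mu_ L'0 brho ug uug).
apply: (@le_lt_trans _ _ ((eps / 3)%:E + (eps / 3)%:E)%E); last first.
  by rewrite -EFinD lte_fin; lra.
apply: leeD; first by apply: Lnorm_le => //; exact: ltW.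
apply: (@le_trans _ _ (Lnorm m p%:E (w \_ A))); last by apply: Lnorm_le => //; exact: ltW.
apply: ereal_inf_lbound; exists (w \_ A) => //; split; first exact: borel_nonneg_patch.
(* [ug_ineq_difference] asks for a finite integral of [rho]; the paths where it fails have modulus
   zero since [rho] is in L^p. *)
exists [set g | Gs g /\ lint mu g rho = +oo%E]; split.
- by move=> g [].
- by apply: (Modp_lint_infty p0 brho Lrho) => g [// /mG].
move=> g Gg ng.
apply: (ug_ineq_difference dM bd mu0 GsG subG mf mu_ L'0 brho ug uug Gg).
by rewrite ltey; apply/eqP => Hoo; apply: ng.
Qed.
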